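(* For all real $p,q\ge2$ there is a constant $C(p,q)$ depending only on $p$ and $q$ such that the following holds. Let $m,n\ge2$ be integers and let $X=(X_{ij})$ be an $m\times n$ real random matrix which, regarded as an $mn$-dimensional random vector $(X_{ij})_{i\le m,j\le n}$, is unconditional. Then $$\mathbb{E}\|X\|_{p',q}\le C(p,q)\biggl((\log m)^{\frac32+\frac1q}\,\mathbb{E}\max_{1\le i\le m}\Bigl(\sum_{j=1}^n|X_{ij}|^p\Bigr)^{1/p}+\sqrt{\log n}\;\mathbb{E}\max_{1\le j\le n}\Bigl(\sum_{i=1}^m|X_{ij}|^q\Bigr)^{1/q}\biggr).$$
   Context: A random vector $Z$ in $\mathbb{R}^d$ is unconditional if for every choice of signs $\eta\in\{-1,1\}^d$ the vectors $Z$ and $(\eta_iZ_i)_{i\le d}$ have the same distribution. For $x\in\mathbb{R}^d$, $\|x\|_r=(\sum_i|x_i|^r)^{1/r}$. $p'$ is the Hölder conjugate of $p$, $\frac1p+\frac1{p'}=1$. $\|X\|_{p',q}=\sup\{\|Xt\|_q:\ t\in\mathbb{R}^n,\ \|t\|_{p'}\le1\}$ is the operator norm from $\ell_{p'}^n$ to $\ell_q^m$. *)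

(* Defs.v *)
From HB Require Import structures.
From mathcomp Require Import all_boot all_order all_algebra.
From mathcomp Require Import all_classical all_reals all_analysis.

Set Implicit Arguments.
Unset Strict Implicit.
Unset Printing Implicit Defensive.

Import Order.TTheory GRing.Theory Num.Theory.

Local Open Scope classical_set_scope.
Local Open Scope ring_scope.

(* [joint Z] is the R^I-valued map with coordinates [Z i]; the finite index
   type I is enumerated in order to use the product sigma-algebra that the
   library puts on tuples. *)
Definition joint (R : realType) (I : finType) (T : Type) (Z : I -> T -> R)
    (w : T) : #|I|.-tuple R :=
  [tuple Z (enum_val k) w | k < #|I|].

(* [eta i] encodes the sign [(-1) ^+ eta i]. *)
Definition unconditional (R : realType) (d : measure_display)
    (T : measurableType d) (P : probability T R) (I : finType)
    (Z : I -> {RV P >-> R}) : Prop :=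
  forall (eta : I -> bool) (A : set (#|I|.-tuple R)), measurable A ->
    pushforward P (joint Z) A =
    pushforward P (joint (fun i w => (-1) ^+ eta i * Z i w)) A.

Definition lnorm (R : realType) (r : R) (I : finType) (x : I -> R) : R :=
  (\sum_i `|x i| `^ r) `^ r^-1.

(* The supremum is over a nonempty set which is bounded (finite dimension) as
   soon as 0 < r, so that the real-valued [sup] is the actual supremum. *)
Definition opnorm (R : realType) (r s : R) (m n : nat) (A : 'M[R]_(m, n)) : R :=
  sup [set lnorm s (fun i => (A *m t) i 0) |
       t in [set t : 'cV[R]_n | lnorm r (fun j => t j 0) <= 1]].

(* Main.v *)
(* Conjugating by independent signs e_ij and averaging, it is enough to bound
   the mean of the norm of (e_ij a_ij) for a fixed matrix a, whose rows may be
   normalised in l_p.  Let y_i be the rows of the signed matrix, let t range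
   over a finite subset of the unit ball of l_p' (a finite 1/4-net gives the
   operator norm up to a factor 4, through a function that is visibly
   measurable), and let S be the maximum over t of sum_i |<y_i, t>|^q.

   For fixed t, Khintchine's inequality and convexity with the weights t_j^2
   bound the mean of the sum by a multiple of max_j ||a_.j||_q^q.  By
   symmetrisation the deviation from the mean is controlled, conditionally on
   y, by the Rademacher process sum_i d_i |<y_i, t>|^q, whose increments are in
   L^2 at most C sqrt(S) max_i |<y_i, s - t>|.  The entropy of the ball of l_p' for
   the latter distance comes from a perceptron argument: mirror descent for
   the 2-smooth potential (1 + ||x||_p^p)^(2/p) approximates every t within u
   after O(1/u^2) steps, each of which chooses a row and a sign, so
   (2m + 1)^O(1/u^2) points suffice.  Chaining over the O(log m) dyadic scales
   down to 1/m gives a bound C (log m)^(3/2) sqrt(S + 1), hence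
   E S <= C (max_j ||a_.j||_q^q + (log m)^3).  Taking q-th roots, the factor
   (log m)^(3/q) is absorbed by (log m)^(3/2 + 1/q) because q >= 2. *)

Require Import Defs.
From HB Require Import structures.
From mathcomp Require Import all_boot all_order all_algebra.
From mathcomp Require Import all_classical all_reals all_analysis.
From mathcomp Require Import measurable_realfun.
From mathcomp Require Import zify ring lra.

Set Implicit Arguments.
Unset Strict Implicit.
Unset Printing Implicit Defensive.

Import Order.TTheory GRing.Theory Num.Theory.

Local Open Scope classical_set_scope.
Local Open Scope ring_scope.

(** * Scalar inequalities *)

Lemma powR_le (R : realType) (x y r : R) :
  0 <= r -> 0 <= x -> x <= y -> x `^ r <= y `^ r.
Proof.
by move=> r0 x0 xy; rewrite ge0_ler_powR ?nnegrE// (le_trans x0).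
Qed.

(** Young's inequality for the product of [x] and [1] with exponents [r] and [r / (r - 1)],
    multiplied by [r]. *)
Lemma powR_young (R : realType) (x r : R) :
  0 <= x -> 1 <= r -> r * x <= x `^ r + (r - 1).
Proof.
move=> x0; rewrite le_eqVlt => /predU1P[<-|r1].
  by rewrite powRr1// mul1r subrr addr0.
have r0 : 0 < r by lra.
have q0 : 0 < r / (r - 1) by rewrite divr_gt0//; lra.
have rq : r^-1 + (r / (r - 1))^-1 = 1.
  by field; apply/andP; split; lra.
have := conjugate_powR x0 (@ler01 R) r0 q0 rq.
rewrite mulr1 powR1 => h.
have := ler_wpM2l (ltW r0) h.
suff -> : r * (x `^ r / r + 1 / (r / (r - 1))) = x `^ r + (r - 1) by [].
by field; apply/andP; split; lra.
Qed.

(** Convexity of the power as a tangent-line bound: [powR_young] at [x / y], rescaled by [y ^ r].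
    The point [y = 0] is treated apart because [0 ^ 0 = 1] enters when [r = 1]. *)
Lemma powR_tangent (R : realType) (x y r : R) :
  0 <= x -> 0 <= y -> 1 <= r -> y `^ r + r * y `^ (r - 1) * (x - y) <= x `^ r.
Proof.
move=> x0; rewrite le_eqVlt => /predU1P[<-|y0] r1.
  rewrite powR0; last by lra.
  rewrite add0r subr0; have [->|r1'] := eqVneq r 1.
    by rewrite subrr powRr0 powRr1// !mul1r.
  by rewrite powR0 ?mulr0 ?mul0r ?powR_ge0// subr_eq0.
have z0 : 0 <= x / y by rewrite divr_ge0// ltW.
have := powR_young z0 r1.
have -> : y `^ (r - 1) = y `^ r / y.
  by rewrite powRB ?powRr1 ?(ltW y0)//; apply/implyP => _; rewrite gt_eqF.
have xE : x `^ r = y `^ r * (x / y) `^ r.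
  by rewrite -powRM ?(ltW y0)// mulrC divfK// gt_eqF.
rewrite xE => h.
have := ler_wpM2l (powR_ge0 y r) h.
suff -> : y `^ r * (r * (x / y)) = y `^ r + r * (y `^ r / y) * (x - y) + (y `^ r) * (r - 1).
  by rewrite mulrDr; lra.
by field; lra.
Qed.

(** The concave counterpart: [powR_young] at [(x / y) ^ a] with the exponent [1 / a]. *)
Lemma powR_concave_tangent (R : realType) (x y a : R) :
  0 <= x -> 0 < y -> 0 < a -> a <= 1 ->
  x `^ a <= y `^ a + a * y `^ (a - 1) * (x - y).
Proof.
move=> x0 y0 a0 a1.
have z0 : 0 <= x / y by rewrite divr_ge0// ltW.
have a1' : 1 <= a^-1 by rewrite invf_ge1.
have := powR_young (powR_ge0 (x / y) a) a1'.
rewrite -powRrM divff ?gt_eqF// powRr1// => h.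
have -> : y `^ (a - 1) = y `^ a / y.
  by rewrite powRB ?powRr1 ?(ltW y0)//; apply/implyP => _; rewrite gt_eqF.
have xE : x `^ a = y `^ a * (x / y) `^ a.
  by rewrite -powRM ?(ltW y0)// mulrC divfK// gt_eqF.
rewrite xE.
have := ler_wpM2l (mulr_ge0 (ltW a0) (powR_ge0 y a)) h.
have -> : a * y `^ a * (a^-1 * (x / y) `^ a) = y `^ a * (x / y) `^ a.
  by field; lra.
move=> /le_trans; apply; rewrite le_eqVlt; apply/orP; left; apply/eqP.
by field; apply/andP; split; lra.
Qed.

Lemma powR_lipschitz (R : realType) (x y b r : R) :
  0 <= x -> x <= b -> 0 <= y -> y <= b -> 1 <= r ->
  `|x `^ r - y `^ r| <= r * b `^ (r - 1) * `|x - y|.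
Proof.
move=> x0 xb y0 yb r1; wlog yx : x y x0 xb y0 yb / y <= x.
  move=> H; have [|/ltW] := leP y x; first exact: H.
  by rewrite distrC (distrC x); exact: H.
have r0 : 0 <= r by lra.
rewrite !ger0_norm ?subr_ge0 ?powR_le//.
have := powR_tangent y0 x0 r1.
have : 0 <= r * (b `^ (r - 1) - x `^ (r - 1)) * (x - y).
  rewrite mulr_ge0 ?subr_ge0// mulr_ge0// subr_ge0 powR_le//; lra.
by lra.
Qed.

(** Squaring and inverting [1 - x / 2 <= exp (- x / 2)] bounds [exp x] by a rational function, which
    a polynomial identity compares with the quadratic. *)
Lemma expR_le_quadratic (R : realType) (x : R) :
  x <= 1 -> expR x <= 1 + x + 2 * x ^+ 2.
Proof.
move=> x1; have : 1 - x / 2 <= expR (- (x / 2)) by exact: expR_ge1Dx.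
have e0 := expR_gt0 (- (x / 2)); move=> h.
have -> : expR x = (expR (- (x / 2)) ^+ 2)^-1.
  by rewrite -expRM_natl -expRN; congr expR; field.
have h2 : (1 - x / 2) ^+ 2 <= expR (- (x / 2)) ^+ 2.
  by rewrite lerXn2r ?nnegrE//; lra.
have p0 : 0 < (1 - x / 2) ^+ 2 by rewrite exprn_gt0//; lra.
apply: (@le_trans _ _ ((1 - x / 2) ^+ 2)^-1).
  by rewrite lef_pV2 ?posrE// exprn_gt0.
rewrite -[leLHS]mul1r ler_pdivrMr//.
have -> : (1 + x + 2 * x ^+ 2) * (1 - x / 2) ^+ 2 =
  1 + x ^+ 2 * ((1 - x) * (5 / 2 - x) / 2) by field.
rewrite lerDl mulr_ge0 ?sqr_ge0// divr_ge0// mulr_ge0//; lra.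
Qed.

(** The sub-Gaussian bound for one sign. For [|x| <= 1] the linear terms of the quadratic bounds
    cancel; for larger [|x|] one has [|x| <= 2 x^2]. *)
Lemma cosh_le (R : realType) (x : R) :
  expR x + expR (- x) <= 2 * expR (2 * x ^+ 2).
Proof.
wlog x0 : x / 0 <= x.
  move=> H; have [|/ltW x0] := leP 0 x; first exact: H.
  by have := H (- x); rewrite oppr_ge0 opprK sqrrN addrC; apply.
have [x1|x1] := leP x 1.
  have h1 := expR_le_quadratic x1.
  have h2 : expR (- x) <= 1 + (- x) + 2 * (- x) ^+ 2.
    by apply: expR_le_quadratic; lra.
  have := expR_ge1Dx (2 * x ^+ 2); rewrite sqrrN in h2; lra.
have : expR x <= expR (2 * x ^+ 2) by rewrite ler_expR; nra.
have : expR (- x) <= expR (2 * x ^+ 2) by rewrite ler_expR; nra.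
lra.
Qed.

Lemma powR_le_expR (R : realType) (x r : R) :
  0 <= x -> 0 < r -> x `^ r <= r `^ r * expR x.
Proof.
move=> x0 r0; have -> : x `^ r = r `^ r * (x / r) `^ r.
  by rewrite -powRM ?divr_ge0 ?(ltW r0)// mulrC divfK// gt_eqF.
rewrite ler_wpM2l ?powR_ge0//.
have -> : expR x = (expR (x / r)) `^ r by rewrite -expRM divfK// gt_eqF.
apply: powR_le; rewrite ?divr_ge0 ?(ltW r0)//.
by apply: le_trans (expR_ge1Dx _); lra.
Qed.

(** The first term pays for the Taylor remainder when [p |x| <= 1]; the second for
    [|1 + x| <= (p + 1) |x|] when [p |x| > 1], where the first absorbs the linear term. *)
Definition smoothness_const (R : realType) (p : R) : R :=
  2 * p ^+ 2 + (p + 1) `^ p.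

Lemma norm1D_powR (R : realType) (p x : R) : 2 <= p ->
  `|1 + x| `^ p <=
    1 + p * x + smoothness_const p * (x ^+ 2 + `|x| `^ p).
Proof.
move=> p2; have p0 : 0 < p by lra.
have C0 : 0 <= (p + 1) `^ p by exact: powR_ge0.
have X0 : 0 <= `|x| `^ p by exact: powR_ge0.
have x20 : 0 <= x ^+ 2 by exact: sqr_ge0.
have := mulr_ge0 C0 X0; have := mulr_ge0 C0 x20.
have := mulr_ge0 (sqr_ge0 p) X0; have := mulr_ge0 (sqr_ge0 p) x20.
rewrite /smoothness_const; have [px|px] := leP (p * `|x|) 1.
  have hx : `|x| <= 1 / 2 by have := normr_ge0 x; nra.
  move: (hx); rewrite ler_norml => /andP[h1 h2].
  have x1 : 0 < 1 + x by lra.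
  have -> : `|1 + x| `^ p = expR (p * ln (1 + x)).
    by rewrite gtr0_norm// mulrC expRM lnK.
  have h3 : p * ln (1 + x) <= p * x.
    by rewrite ler_pM2l// le_ln1Dx//; lra.
  have h4 : expR (p * ln (1 + x)) <= expR (p * x) by rewrite ler_expR.
  have h5 : expR (p * x) <= 1 + p * x + 2 * (p * x) ^+ 2.
    apply: expR_le_quadratic; apply: le_trans px.
    by rewrite ler_pM2l// ler_norm.
  rewrite exprMn in h5; nra.
have h1 : `|1 + x| `^ p <= (p + 1) `^ p * `|x| `^ p.
  rewrite -powRM ?normr_ge0//; last by lra.
  apply: powR_le; rewrite ?normr_ge0//; first lra.
  by apply: (le_trans (ler_normD _ _)); rewrite normr1; lra.
have h2 : p * `|x| <= p ^+ 2 * x ^+ 2.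
  by rewrite -(real_normK (num_real x)) -exprMn; nra.
have h3 : - (p * x) <= p * `|x|.
  by rewrite -mulrN ler_pM2l// -normrN ler_norm.
nra.
Qed.

(** The homogeneous form of [norm1D_powR], taken at [b / a] and multiplied by [|a| ^ p]. *)
Lemma normD_powR (R : realType) (p a b : R) : 2 <= p ->
  `|a + b| `^ p <= `|a| `^ p + p * (a * `|a| `^ (p - 2) * b) +
    smoothness_const p * (`|a| `^ (p - 2) * b ^+ 2 + `|b| `^ p).
Proof.
move=> p2; have [->|a0] := eqVneq a 0.
  rewrite add0r normr0 !mul0r !mulr0 addr0.
  rewrite powR0; last by lra.
  have : 0 <= `|b| `^ p by exact: powR_ge0.
  have : 0 <= (0 : R) `^ (p - 2) * b ^+ 2 by rewrite mulr_ge0 ?powR_ge0 ?sqr_ge0.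
  have : 0 <= (p + 1) `^ p by exact: powR_ge0.
  have : 1 <= 2 * p ^+ 2 by nra.
  rewrite /smoothness_const; nra.
have na0 : 0 < `|a| by rewrite normr_gt0.
have -> : `|a + b| `^ p = `|a| `^ p * `|1 + b / a| `^ p.
  by rewrite -powRM ?normr_ge0// -normrM mulrDr mulr1 mulrCA divff// mulr1.
have -> : `|b| `^ p = `|a| `^ p * `|b / a| `^ p.
  by rewrite -powRM ?normr_ge0// -normrM mulrCA divff// mulr1.
have aE : `|a| `^ (p - 2) = `|a| `^ p / a ^+ 2.
  rewrite powRB; last by apply/implyP => _; rewrite gt_eqF.
  by rewrite powR_mulrn// real_normK// num_real.
have := ler_wpM2l (powR_ge0 `|a| p) (norm1D_powR (b / a) p2).
move=> /le_trans; apply; rewrite aE le_eqVlt; apply/orP; left; apply/eqP.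
by field.
Qed.

(** * Averages over signs *)

(** Expectation under the uniform law. Sign patterns form a finite type, so that all the probability
    on signs consists of finite sums. *)
Definition avg (R : realType) (W : finType) (f : W -> R) : R :=
  (\sum_w f w) / #|W|%:R.

Definition radsum (R : realType) (I : finType) (e : I -> bool) (c : I -> R) : R :=
  \sum_i (-1) ^+ e i * c i.

Lemma ler_avg (R : realType) (W : finType) (f g : W -> R) :
  (forall w, f w <= g w) -> avg f <= avg g.
Proof.
by move=> fg; rewrite /avg ler_wpM2r ?invr_ge0// ler_sum.
Qed.

Lemma avg_ge0 (R : realType) (W : finType) (f : W -> R) :
  (forall w, 0 <= f w) -> 0 <= avg f.
Proof. by move=> f0; rewrite /avg divr_ge0// sumr_ge0. Qed.

Lemma avgD (R : realType) (W : finType) (f g : W -> R) :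
  avg (fun w => f w + g w) = avg f + avg g.
Proof. by rewrite /avg big_split mulrDl. Qed.

Lemma avgZl (R : realType) (W : finType) (a : R) (f : W -> R) :
  avg (fun w => a * f w) = a * avg f.
Proof. by rewrite /avg -mulr_sumr mulrA. Qed.

Lemma avg_sum (R : realType) (W J : finType) (P : pred J) (f : J -> W -> R) :
  avg (fun w => \sum_(j | P j) f j w) = \sum_(j | P j) avg (f j).
Proof. by rewrite /avg exchange_big mulr_suml. Qed.

Lemma exchange_avg (R : realType) (W V : finType) (f : W -> V -> R) :
  avg (fun w => avg (f w)) = avg (fun v => avg (f ^~ v)).
Proof.
rewrite /avg -[in LHS]mulr_suml -[in RHS]mulr_suml exchange_big/=.
by rewrite mulrAC.
Qed.

Lemma avg_cst (R : realType) (I : finType) (a : R) :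
  avg (fun _ : {ffun I -> bool} => a) = a.
Proof.
rewrite /avg sumr_const -(mulr_natr a) mulfK//.
by rewrite pnatr_eq0 card_ffun card_bool expn_eq0.
Qed.

(** Independence of the signs is distributivity: the sum over sign patterns of a product is a
    product of two-term sums, each bounded by [cosh_le]. *)
Lemma avg_expR_radsum (R : realType) (I : finType) (c : I -> R) :
  avg (fun e : {ffun I -> bool} => expR (radsum e c)) <=
  expR (2 * \sum_i c i ^+ 2).
Proof.
rewrite /avg /radsum.
have -> : \sum_(e : {ffun I -> bool}) expR (\sum_i (-1) ^+ e i * c i) =
    \prod_i (expR (c i) + expR (- c i)).
  under [LHS]eq_bigr do rewrite expR_sum.
  rewrite -(bigA_distr_bigA (fun i (b : bool) => expR ((-1) ^+ b * c i))).
  apply: eq_bigr => i _; rewrite big_bool/= expr1 expr0 mulN1r mul1r addrC.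
  by [].
rewrite mulr_sumr expR_sum ler_pdivrMr; last first.
  by rewrite ltr0n card_ffun card_bool expn_gt0.
rewrite card_ffun card_bool natrX mulrC.
have -> : 2%:R ^+ #|I| * \prod_i expR (2 * c i ^+ 2) =
    \prod_(i : I) (2 * expR (2 * c i ^+ 2)) :> R.
  by rewrite big_split/= prodr_const.
by apply: ler_prod => i _; rewrite cosh_le addr_ge0 ?expR_ge0.
Qed.

Lemma radsumZ (R : realType) (I : finType) (e : I -> bool) (a : R) (c : I -> R) :
  radsum e (fun i => a * c i) = a * radsum e c.
Proof.
by rewrite /radsum mulr_sumr; apply: eq_bigr => i _; rewrite mulrCA.
Qed.

Lemma radsumB (R : realType) (I : finType) (e : I -> bool) (c c' : I -> R) :
  radsum e (fun i => c i - c' i) = radsum e c - radsum e c'.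
Proof. by rewrite /radsum -sumrB; apply: eq_bigr => i _; rewrite mulrBr. Qed.

Lemma avg_expR_radsumZ (R : realType) (I : finType) (l : R) (c : I -> R) :
  avg (fun e : {ffun I -> bool} => expR (l * radsum e c)) <=
  expR (2 * l ^+ 2 * \sum_i c i ^+ 2).
Proof.
have := avg_expR_radsum (fun i => l * c i).
rewrite (_ : \sum_i (l * c i) ^+ 2 = l ^+ 2 * \sum_i c i ^+ 2).
  by rewrite -mulrA; under [X in avg X]eq_fun do rewrite radsumZ.
by rewrite mulr_sumr; apply: eq_bigr => i _; rewrite exprMn.
Qed.

Lemma expR_norm_le (R : realType) (x : R) : expR `|x| <= expR x + expR (- x).
Proof.
have [x0|x0] := ger0P x; first by rewrite lerDl expR_ge0.
by rewrite lerDr expR_ge0.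
Qed.

(** The sub-Gaussian maximal inequality: at the level of exponential moments the maximum costs a
    factor [2 #|A|], which [exp (B ^ 2)] pays for. *)
Lemma avg_max_radsum (R : realType) (I J : finType) (A : {set J})
    (c : J -> I -> R) (s B : R) :
  0 < s -> 1 <= B -> (forall j, j \in A -> \sum_i c j i ^+ 2 <= s ^+ 2) ->
  2 * #|A|%:R <= expR (B ^+ 2) ->
  avg (fun e : {ffun I -> bool} => \big[Num.max/0]_(j in A) `|radsum e (c j)|)
    <= 4 * s * B.
Proof.
move=> s0 B1 cs AB.
have B0 : 0 < B by lra.
(* for l = B / s, bound l |Z| by 3 B^2 + expR (l |Z| - 3 B^2) and take means *)
pose l := B / s; have l0 : 0 < l by rewrite divr_gt0.
rewrite -(ler_pM2l l0) -avgZl.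
apply: (@le_trans _ _ (avg (fun e : {ffun I -> bool} => 3 * B ^+ 2 +
    expR (- (3 * B ^+ 2)) * \sum_(j in A)
      (expR (l * radsum e (c j)) + expR (- l * radsum e (c j)))))).
  apply: ler_avg => e.
  have S0 j : 0 <= expR (l * radsum e (c j)) + expR (- l * radsum e (c j)).
    by rewrite addr_ge0 ?expR_ge0.
  rewrite -ler_pdivlMl//; apply: bigmax_le => [|j jA].
    apply: mulr_ge0; first by rewrite invr_ge0 ltW.
    by rewrite addr_ge0// mulr_ge0 ?sqr_ge0 ?expR_ge0 ?sumr_ge0.
  rewrite ler_pdivlMl// -lerBlDl.
  have h := expR_ge1Dx (l * `|radsum e (c j)| - 3 * B ^+ 2).
  apply: (@le_trans _ _ (expR (l * `|radsum e (c j)| - 3 * B ^+ 2))); first lra.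
  rewrite addrC expRD ler_wpM2l ?expR_ge0// (bigD1 j)//=.
  rewrite -[l in leLHS]gtr0_norm// -normrM.
  apply: (le_trans (expR_norm_le _)); rewrite -mulNr lerDl.
  by rewrite sumr_ge0.
rewrite avgD avg_cst avgZl avg_sum.
have h : \sum_(j in A) avg (fun e : {ffun I -> bool} =>
     expR (l * radsum e (c j)) + expR (- l * radsum e (c j))) <=
    \sum_(j in A) 2 * expR (2 * B ^+ 2).
  apply: ler_sum => j jA; rewrite avgD.
  have h1 := avg_expR_radsumZ l (c j).
  have h2 := avg_expR_radsumZ (- l) (c j).
  have : 2 * l ^+ 2 * \sum_i c j i ^+ 2 <= 2 * B ^+ 2.
    have -> : 2 * B ^+ 2 = 2 * l ^+ 2 * s ^+ 2 by rewrite /l; field; lra.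
    by rewrite ler_wpM2l ?cs// mulr_ge0 ?sqr_ge0.
  rewrite -ler_expR; rewrite sqrrN in h2; lra.
rewrite sumr_const -[_ *+ #|_|]mulr_natl in h.
have {}h : \sum_(j in A) avg (fun e : {ffun I -> bool} =>
     expR (l * radsum e (c j)) + expR (- l * radsum e (c j))) <= expR (3 * B ^+ 2).
  apply: (le_trans h); rewrite mulrCA mulrA.
  have -> : 3 * B ^+ 2 = B ^+ 2 + 2 * B ^+ 2 by ring.
  by rewrite expRD ler_wpM2r ?expR_ge0.
have := ler_wpM2l (expR_ge0 (- (3 * B ^+ 2))) h.
rewrite -expRD addNr expR0 => {}h.
have -> : l * (4 * s * B) = 4 * B ^+ 2 by rewrite /l; field; lra.
by nra.
Qed.

(** Khintchine's inequality. After division by the l_2 norm [s] of [c], the power is dominated by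
    [q ^ q] times an exponential, whose mean is at most [exp 2]. *)
Lemma avg_radsum_powR (R : realType) (I : finType) (c : I -> R) (q : R) :
  2 <= q ->
  avg (fun e : {ffun I -> bool} => `|radsum e c| `^ q) <=
  2 * q `^ q * expR 2 * (\sum_i c i ^+ 2) `^ (q / 2).
Proof.
move=> q2; set S := \sum_i _.
have S0 : 0 <= S by apply: sumr_ge0 => i _; exact: sqr_ge0.
have [Sz|Sz] := eqVneq S 0.
  have c0 i : c i = 0.
    apply/eqP; rewrite -sqrf_eq0; move/eqP: Sz.
    rewrite psumr_eq0; last by move=> *; exact: sqr_ge0.
    by move/allP/(_ i); rewrite mem_index_enum; apply.
  rewrite Sz powR0; last by lra.
  rewrite mulr0 -[leRHS](avg_cst I); apply: ler_avg => e.
  rewrite /radsum big1 ?normr0 ?powR0//; first by lra.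
  by move=> i _; rewrite c0 mulr0.
pose s := Num.sqrt S.
have s0 : 0 < s by rewrite sqrtr_gt0 lt_neqAle eq_sym Sz.
have sS : s ^+ 2 = S by rewrite sqr_sqrtr.
have -> : S `^ (q / 2) = s `^ q.
  by rewrite -sS -powR_mulrn ?(ltW s0)// -powRrM mulrCA divff// mulr1.
apply: (@le_trans _ _ (avg (fun e : {ffun I -> bool} => s `^ q * q `^ q *
   (expR (s^-1 * radsum e c) + expR (- s^-1 * radsum e c))))).
  apply: ler_avg => e.
  have -> : `|radsum e c| `^ q = s `^ q * `|s^-1 * radsum e c| `^ q.
    rewrite -powRM ?normr_ge0 ?(ltW s0)// normrM gtr0_norm ?invr_gt0//.
    by rewrite mulrA divff ?mul1r// gt_eqF.
  rewrite -mulrA ler_wpM2l ?powR_ge0//.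
  apply: le_trans (powR_le_expR (normr_ge0 _) _) _; first lra.
  by rewrite ler_wpM2l ?powR_ge0// mulNr expR_norm_le.
rewrite avgZl avgD.
have h1 := avg_expR_radsumZ s^-1 c.
have := avg_expR_radsumZ (- s^-1) c.
have e2 : 2 * s^-1 ^+ 2 * S = 2 by rewrite -sS; field; lra.
rewrite sqrrN -/S e2 => h2; rewrite -/S e2 in h1.
have : 0 <= s `^ q * q `^ q by rewrite mulr_ge0 ?powR_ge0.
by nra.
Qed.

(** * Entropy of the ball by mirror descent *)

Definition psum (R : realType) (J : finType) (p : R) (x : J -> R) : R :=
  \sum_j `|x j| `^ p.

Definition dot (R : realType) (J : finType) (x y : J -> R) : R :=
  \sum_j x j * y j.

Lemma psum_ge0 (R : realType) (J : finType) (p : R) (x : J -> R) :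
  0 <= psum p x.
Proof. by apply: sumr_ge0 => j _; exact: powR_ge0. Qed.

Lemma psumZ (R : realType) (J : finType) (p a : R) (x : J -> R) :
  psum p (fun j => a * x j) = `|a| `^ p * psum p x.
Proof.
by rewrite /psum mulr_sumr; apply: eq_bigr => j _; rewrite normrM powRM.
Qed.

Lemma dotC (R : realType) (J : finType) (x y : J -> R) : dot x y = dot y x.
Proof. by apply: eq_bigr => j _; rewrite mulrC. Qed.

Lemma dotDr (R : realType) (J : finType) (x y z : J -> R) :
  dot x (fun j => y j + z j) = dot x y + dot x z.
Proof. by rewrite /dot -big_split; apply: eq_bigr => j _; rewrite mulrDr. Qed.

Lemma dotZr (R : realType) (J : finType) (x y : J -> R) (a : R) :
  dot x (fun j => a * y j) = a * dot x y.
Proof. by rewrite /dot mulr_sumr; apply: eq_bigr => j _; rewrite mulrCA. Qed.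

(** Hölder's inequality on unit balls, by summing Young's inequality over the coordinates. *)
Lemma abs_dot_le1 (R : realType) (J : finType) (p p' : R) (x t : J -> R) :
  0 < p -> 0 < p' -> p^-1 + p'^-1 = 1 -> psum p x <= 1 -> psum p' t <= 1 ->
  `|dot x t| <= 1.
Proof.
move=> p0 p'0 pp' x1 t1.
apply: (@le_trans _ _ (psum p x / p + psum p' t / p')).
  apply: (le_trans (ler_norm_sum _ _ _)).
  rewrite /psum 2!mulr_suml -big_split/=; apply: ler_sum => j _.
  by rewrite normrM conjugate_powR.
have ip0 : 0 < p^-1 by rewrite invr_gt0.
have ip'0 : 0 < p'^-1 by rewrite invr_gt0.
nra.
Qed.

Lemma smoothness_const_ge1 (R : realType) (p : R) :
  1 <= p -> 1 <= smoothness_const p.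
Proof.
move=> p1; have := powR_ge0 (p + 1) p; rewrite /smoothness_const; nra.
Qed.

(** The added [1] keeps the base positive, so that the concave tangent bound applies at the origin
    too. *)
Definition potential (R : realType) (J : finType) (p : R) (x : J -> R) : R :=
  (1 + psum p x) `^ (2 / p).

Definition potential_grad (R : realType) (J : finType) (p : R) (x : J -> R)
    (j : J) : R :=
  2 * (1 + psum p x) `^ (2 / p - 1) * (x j * `|x j| `^ (p - 2)).

Lemma powR_mulM2 (R : realType) (p a b : R) : 2 <= p -> 0 <= a -> 0 <= b ->
  a `^ (p - 2) * b ^+ 2 <= a `^ p + b `^ p.
Proof.
move=> p2; have pE x : 0 <= x -> x `^ (p - 2) * x ^+ 2 = x `^ p.
  move=> x0; rewrite -powR_mulrn// -powRD ?subrK//.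
  by apply/implyP => /eqP; lra.
move=> a0 b0; have [ab|/ltW ba] := leP a b.
  apply: (@le_trans _ _ (b `^ p)); last by rewrite lerDr powR_ge0.
  by rewrite -(pE b)// ler_wpM2r ?sqr_ge0// powR_le//; lra.
apply: (@le_trans _ _ (a `^ p)); last by rewrite lerDl powR_ge0.
by rewrite -(pE a)// ler_wpM2l ?powR_ge0// lerXn2r.
Qed.

(** With [r = (1 + psum p x) ^ (1 / p)] the potential is [r ^ 2], Hölder gives [dot t x <= r], and
    [r - 1 <= r ^ 2]. *)
Lemma potential_ge_dot (R : realType) (J : finType) (p p' : R) (x t : J -> R) :
  0 < p -> 0 < p' -> p^-1 + p'^-1 = 1 -> psum p' t <= 1 ->
  dot t x - 1 <= potential p x.
Proof.
move=> p0 p'0 pp' t1; have N0 := psum_ge0 p x.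
pose r := (1 + psum p x) `^ p^-1.
have r0 : 0 < r by rewrite powR_gt0//; lra.
have -> : potential p x = r ^+ 2.
  by rewrite -powR_mulrn ?(ltW r0)// -powRrM mulrC.
have rp : r `^ p = 1 + psum p x.
  by rewrite -powRrM mulVf ?gt_eqF// powRr1//; lra.
have : `|dot (fun j => r^-1 * x j) t| <= 1.
  apply: abs_dot_le1 p0 p'0 pp' _ t1; rewrite psumZ gtr0_norm ?invr_gt0//.
  rewrite -powR_inv1 ?(ltW r0)// -powRrM mulN1r powRN rp mulrC ler_pdivrMr; lra.
rewrite dotC dotZr ler_norml => /andP[_].
rewrite ler_pdivrMl// mulr1; nra.
Qed.

(** 2-smoothness of the potential. [normD_powR] expands [psum] to second order, and concavity of the
    power [2 / p] transfers this to the potential. The constant 3 adds the bounds [w * Q <= 2] and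
    [w <= 1]. *)
Lemma potential_step (R : realType) (J : finType) (p a : R) (x y : J -> R) :
  2 <= p -> `|a| <= 1 -> psum p y <= 1 ->
  potential p (fun j => x j + a * y j) <=
  potential p x + a * dot (potential_grad p x) y +
  3 * smoothness_const p * a ^+ 2.
Proof.
move=> p2 a1 y1; have p0 : 0 < p by lra.
set K := smoothness_const p.
have K0 : 0 <= K by apply: le_trans (smoothness_const_ge1 _); lra.
have N0 := psum_ge0 p x; set N := psum p x in N0 *.
have N10 : 0 < 1 + N by lra.
have a20 : 0 < 2 / p by rewrite divr_gt0.
have a21 : 2 / p <= 1 by rewrite ler_pdivrMr// mul1r.
set N' := psum p (fun j => x j + a * y j).
have N'0 : 0 <= N' by exact: psum_ge0.
set G := \sum_j (x j * `|x j| `^ (p - 2)) * y j.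
set Q := \sum_j `|x j| `^ (p - 2) * y j ^+ 2.
have hN : N' <= N + p * (a * G) + K * (a ^+ 2 * Q + a ^+ 2).
  apply: (@le_trans _ _ (N + p * (a * G) +
      K * (a ^+ 2 * Q + psum p (fun j => a * y j)))).
    rewrite /N' /N /psum /G /Q !mulr_sumr -!big_split/= mulr_sumr -big_split/=.
    apply: ler_sum => j _; apply: (le_trans (normD_powR _ _ p2)).
    rewrite le_eqVlt; apply/orP; left; apply/eqP.
    rewrite -/K; ring.
  rewrite lerD2l ler_wpM2l// lerD2l psumZ.
  have h : `|a| `^ p <= a ^+ 2.
    rewrite -(real_normK (num_real a)) -powR_mulrn//.
    have [->|an0] := eqVneq `|a| 0; first by rewrite !powR0//; lra.
    by apply: ger_powR => //; rewrite a1 lt_neqAle eq_sym an0 normr_ge0.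
  have := powR_ge0 `|a| p; have := psum_ge0 p y; nra.
set w := (1 + N) `^ (2 / p - 1).
have w0 : 0 <= w by exact: powR_ge0.
have w1 : w <= 1.
  rewrite -[leRHS](powRr0 (1 + N)); apply: ler_powR; lra.
(* w = (1 + N)^(- (p - 2) / p) rescales x into the unit ball of l_p *)
have wQ : w * Q <= 2.
  pose r := (1 + N) `^ p^-1.
  have r0 : 0 < r by rewrite powR_gt0.
  have wE : w = r^-1 `^ (p - 2).
    rewrite -powR_inv1 ?(ltW r0)// -!powRrM; congr powR; field; lra.
  have rp : r^-1 `^ p = (1 + N)^-1.
    by rewrite -powR_inv1 ?(ltW r0)// -!powRrM mulN1r mulrN mulVf ?gt_eqF//
      powR_inv1// ltW.
  apply: (@le_trans _ _ (\sum_j ((r^-1 * `|x j|) `^ p + `|y j| `^ p))).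
    rewrite mulr_sumr; apply: ler_sum => j _.
    apply: le_trans (powR_mulM2 p2 _ _); rewrite ?mulr_ge0 ?invr_ge0 ?(ltW r0)//.
    rewrite powRM ?invr_ge0 ?(ltW r0)// -wE real_normK ?num_real//.
    by rewrite mulrA.
  rewrite big_split/=; under eq_bigr do rewrite powRM ?invr_ge0 ?(ltW r0)//.
  rewrite -mulr_sumr -/(psum p x) -/N -/(psum p y) rp.
  have : (1 + N)^-1 * N <= 1 by rewrite mulrC ler_pdivrMr//; lra.
  lra.
rewrite /potential -/N -/N'.
apply: le_trans (powR_concave_tangent (addr_ge0 ler01 N'0) N10 a20 a21) _.
rewrite -/w.
have -> : dot (potential_grad p x) y = 2 * w * G.
  by rewrite /dot /G mulr_sumr; apply: eq_bigr => j _; rewrite mulrA.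
rewrite -[leRHS]addrA lerD2l.
have aw0 : 0 <= 2 / p * w by rewrite mulr_ge0// ltW.
apply: (@le_trans _ _ (2 / p * w * (p * (a * G) + K * (a ^+ 2 * Q + a ^+ 2)))).
  by rewrite ler_wpM2l//; lra.
have -> : 2 / p * w * (p * (a * G) + K * (a ^+ 2 * Q + a ^+ 2)) =
   a * (2 * w * G) + 2 / p * (K * a ^+ 2 * (w * Q + w)).
  by field; lra.
rewrite lerD2l.
have Ka : 0 <= K * a ^+ 2 by rewrite mulr_ge0 ?sqr_ge0.
have wQ0 : 0 <= w * Q.
  rewrite mulr_ge0// sumr_ge0// => j _.
  by rewrite mulr_ge0 ?powR_ge0 ?sqr_ge0.
have : K * a ^+ 2 * (w * Q + w) <= K * a ^+ 2 * 3 by rewrite ler_wpM2l//; lra.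
have : 0 <= K * a ^+ 2 * (w * Q + w) by rewrite mulr_ge0//; lra.
nra.
Qed.

(* The mirror-descent iterate with step [h] encoded by [s]: [Some (i, b)] is
   the update along the row [y i] with sign [(-1) ^+ b], [None] an idle step
   that pads codes to a common length. *)
Definition code_point (R : realType) (I J : finType) (y : I -> J -> R) (h : R)
    (s : seq (option (I * bool))) : J -> R :=
  foldr (fun (c : option (I * bool)) (x : J -> R) =>
           if c is Some (i, b) then fun j => x j + h * (-1) ^+ b * y i j
           else x) (fun _ => 0) s.

(** The step [h = u / (6 K)] maximises the guaranteed decrease [h u - 3 K h^2]. *)
Lemma perceptron_gain (R : realType) (K u : R) : 1 <= K ->
  u / (6 * K) * u - 3 * K * (u / (6 * K)) ^+ 2 = u ^+ 2 / (12 * K).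
Proof. by move=> K1; field; lra. Qed.

(* As long as some row separates t from the current iterate by more than u,
   the regret [potential p x - dot t x] drops by u^2 / (12 K); it starts at 1
   and is at least -1 by [potential_ge_dot]. *)
Lemma exists_code (R : realType) (I J : finType) (p p' u : R) (y : I -> J -> R)
    (t : J -> R) (M : nat) :
  2 <= p -> 0 < p' -> p^-1 + p'^-1 = 1 -> (forall i, psum p (y i) <= 1) ->
  psum p' t <= 1 -> 0 < u -> u <= 1 ->
  let h := u / (6 * smoothness_const p) in
  exists s : seq (option (I * bool)), size s = M /\
    ((forall i, `|dot (y i) t - dot (y i) (potential_grad p (code_point y h s))|
        <= u) \/
     potential p (code_point y h s) - dot t (code_point y h s) <=
       1 - M%:R * (u ^+ 2 / (12 * smoothness_const p))).
Proof.
move=> p2 p'0 pp' y1 t1 u0 u1 h; set K := smoothness_const p.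
have K1 : 1 <= K by apply: smoothness_const_ge1; lra.
have h0 : 0 < h by rewrite /h -/K divr_gt0//; lra.
have h1 : h <= 1 by rewrite /h -/K ler_pdivrMr; lra.
elim: M => [|M [s [sM]]].
  exists [::]; split=> //; right.
  rewrite mul0r subr0 /potential /dot /=.
  rewrite [in X in _ - X]big1 => [|j _]; last by rewrite mulr0.
  rewrite /psum big1 => [|j _]; last by rewrite normr0 powR0//; lra.
  by rewrite addr0 powR1 subr0.
case=> [happ|hD].
  by exists (None :: s); rewrite /= sM; split=> //; left.
set x := code_point y h s in hD *.
have [happ|] := pselect (forall i,
    `|dot (y i) t - dot (y i) (potential_grad p x)| <= u).
  by exists (None :: s); rewrite /= sM; split=> //; left.
move=> /existsNP[i /negP]; rewrite -ltNge => hi.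
(* The sign of the update is that of the violated gap, so the first-order gain is [h] times its
   absolute value. *)
pose b := dot (y i) t - dot (y i) (potential_grad p x) < 0.
exists (Some (i, b) :: s); split; first by rewrite /= sM.
right; rewrite /= -/x.
set a := h * (-1) ^+ b.
have a1 : `|a| = h by rewrite normrM normr_sign mulr1 gtr0_norm.
have a2 : a ^+ 2 = h ^+ 2 by rewrite exprMn sqrr_sign mulr1.
have ah : a * (dot (y i) t - dot (y i) (potential_grad p x)) =
    h * `|dot (y i) t - dot (y i) (potential_grad p x)|.
  rewrite /a -mulrA; congr (_ * _); rewrite /b; case: ltP => H.
    by rewrite expr1 mulN1r ltr0_norm.
  by rewrite expr0 mul1r ger0_norm.
have hstep : potential p (fun j => x j + a * y i j) <=
    potential p x + a * dot (y i) (potential_grad p x) + 3 * K * h ^+ 2.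
  by rewrite -a2 (dotC (y i)); apply: potential_step; rewrite ?a1.
have hgain : h * u <= a * dot (y i) t - a * dot (y i) (potential_grad p x).
  by rewrite -mulrBr ah ler_pM2l// ltW.
have E : h * u - 3 * K * h ^+ 2 = u ^+ 2 / (12 * K).
  exact: perceptron_gain.
rewrite dotDr dotZr (dotC t (y i)) -natr1 mulrDl mul1r -E.
rewrite -E in hD; move: hD hstep hgain; clear; clearbody x K a h.
move: (dot _ _) (dot _ _) (dot _ _) (potential _ _) (potential _ _) (M%:R * _).
by move=> *; lra.
Qed.

(** Points with the same code are both within [u] of one approximant, hence within [2 u] of each
    other; one representative per code makes a net. Each step has [2 #|I| + 1] choices: a row with a
    sign, or idling. *)
Lemma net_map (R : realType) (I J K : finType) (p p' u : R) (y : I -> J -> R)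
    (t : K -> J -> R) (M : nat) :
  2 <= p -> 0 < p' -> p^-1 + p'^-1 = 1 -> (forall i, psum p (y i) <= 1) ->
  (forall k, psum p' (t k) <= 1) -> 0 < u -> u <= 1 ->
  24 * smoothness_const p < M%:R * u ^+ 2 ->
  exists g : K -> K,
    (#|[set g k | k : K]| <= (2 * #|I|).+1 ^ M)%N /\
    forall k i, `|dot (y i) (t k) - dot (y i) (t (g k))| <= 2 * u.
Proof.
move=> p2 p'0 pp' y1 t1 u0 u1 hM; have p0 : 0 < p by lra.
have K0 : 0 < smoothness_const p.
  by apply: lt_le_trans (smoothness_const_ge1 _); lra.
pose h := u / (6 * smoothness_const p).
have code k : exists s : M.-tuple (option (I * bool)), forall i,
    `|dot (y i) (t k) - dot (y i) (potential_grad p (code_point y h s))| <= u.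
  have [s [/eqP sM [?|hD]]] := exists_code M p2 p'0 pp' y1 (t1 k) u0 u1.
    by exists (Tuple sM).
  have := potential_ge_dot (code_point y h s) p0 p'0 pp' (t1 k).
  (* [M] steps would lower the regret by more than 2, from 1 to below its lower bound -1, so the
     approximation must have succeeded. *)
  have : 2 < M%:R * (u ^+ 2 / (12 * smoothness_const p)).
    by rewrite mulrA ltr_pdivlMr ?mulr_gt0//; lra.
  move: hD; rewrite -/h; set v := M%:R * _; lra.
have [c cP] := choice code.
(* The default is never taken, since [k] itself has the code [c k]. *)
pose g k := odflt k [pick k' | c k' == c k].
have cg k : c (g k) = c k.
  by rewrite /g; case: pickP => [k' /eqP//|/(_ k)]; rewrite eqxx.
exists g; split.
  have -> : ((2 * #|I|).+1 ^ M = #|{: M.-tuple (option (I * bool))}|)%N.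
    by rewrite card_tuple card_option card_prod card_bool mulnC.
  rewrite -(@card_in_imset _ _ c); first exact: max_card.
  move=> _ _ /imsetP[k _ ->] /imsetP[k' _ ->]; rewrite !cg /g => <-.
  by case: pickP => [//|/(_ k)]; rewrite eqxx.
move=> k i.
have := cP k i; have := cP (g k) i; rewrite cg.
set z := dot _ (potential_grad _ _); rewrite !ler_norml; lra.
Qed.

(** * Chaining *)

(** The power has slope at most [q b ^ (q - 1)] up to [b = max(|x i|, |z i|)]. Since [b <= 1] and
    [q >= 2], the square of [b ^ (q - 1)] is at most [b ^ q], which sums to at most [2 S]. *)
Lemma sum_sqr_powR_diff (R : realType) (I : finType) (q d S : R)
    (x z : I -> R) :
  2 <= q -> 0 <= d -> (forall i, `|x i| <= 1) -> (forall i, `|z i| <= 1) ->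
  (forall i, `|x i - z i| <= d) ->
  psum q x <= S -> psum q z <= S ->
  \sum_i (`|x i| `^ q - `|z i| `^ q) ^+ 2 <= 2 * (q * d) ^+ 2 * S.
Proof.
move=> q2 d0 x1 z1 xz xS zS.
apply: (@le_trans _ _ (\sum_i (q * d) ^+ 2 * (`|x i| `^ q + `|z i| `^ q))).
  apply: ler_sum => i _.
  pose b := Num.max `|x i| `|z i|.
  have b0 : 0 <= b by rewrite le_max normr_ge0.
  have h : `| `|x i| `^ q - `|z i| `^ q| <= q * b `^ (q - 1) * d.
    apply: (@le_trans _ _ (q * b `^ (q - 1) * `| `|x i| - `|z i| |)).
      by apply: powR_lipschitz; rewrite ?normr_ge0// ?le_max ?lexx ?orbT//; lra.
    rewrite ler_wpM2l ?mulr_ge0 ?powR_ge0//; first lra.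
    exact: le_trans (ler_dist_dist _ _) (xz i).
  have hb : (b `^ (q - 1)) ^+ 2 <= `|x i| `^ q + `|z i| `^ q.
    have bb : (b `^ (q - 1)) ^+ 2 <= b `^ q.
      rewrite -powR_mulrn ?powR_ge0// -powRrM.
      have [->|bn0] := eqVneq b 0.
        by rewrite !powR0//; lra.
      apply: ger_powR; last lra.
      by rewrite lt_neqAle eq_sym bn0 b0 ge_max x1 z1.
    apply: (le_trans bb); rewrite /b maxEle; case: ifP => _.
      by rewrite lerDr powR_ge0.
    by rewrite lerDl powR_ge0.
  rewrite -(real_normK (num_real (_ - _))).
  apply: (@le_trans _ _ ((q * b `^ (q - 1) * d) ^+ 2)).
    by rewrite lerXn2r ?nnegrE ?mulr_ge0 ?powR_ge0//; lra.
  rewrite (_ : (q * b `^ (q - 1) * d) ^+ 2 =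
    (q * d) ^+ 2 * (b `^ (q - 1)) ^+ 2); last by ring.
  by rewrite ler_wpM2l ?sqr_ge0.
rewrite -mulr_sumr big_split/= -/(psum q x) -/(psum q z).
have := sqr_ge0 (q * d); nra.
Qed.

Lemma chaining (R : realType) (I J K : finType) (p p' q s b : R)
    (y : I -> J -> R) (t : K -> J -> R) (L T : nat) :
  2 <= p -> 0 < p' -> p^-1 + p'^-1 = 1 -> 2 <= q ->
  (forall i, psum p (y i) <= 1) -> (forall k, psum p' (t k) <= 1) ->
  1 <= s -> (forall k, psum q (fun i => dot (y i) (t k)) <= s ^+ 2) ->
  1 <= b -> (#|I| <= 2 ^ L)%N -> (1 < #|I|)%N -> 24 * smoothness_const p < T%:R ->
  (2 * #|I|).+1%:R ^+ (6 * T) <= expR (b ^+ 2) ->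
  avg (fun e : {ffun I -> bool} => \big[Num.max/0]_k
        `|radsum e (fun i => `|dot (y i) (t k)| `^ q)|)
    <= 26 * q * (L%:R + 1) * b * s.
Proof.
move=> p2 p'0 pp' q2 y1 t1 s1 tS b1 IL I1 hT hb.
have p0 : 0 < p by lra.
set f := fun k i => `|dot (y i) (t k)| `^ q.
have d1 k i : `|dot (y i) (t k)| <= 1 by exact: abs_dot_le1 p0 p'0 pp' _ _.
have T0 : (0 < T)%N.
  rewrite -(ltr_nat R); apply: le_lt_trans hT.
  by rewrite mulr_ge0// ltW// (lt_le_trans ltr01)// smoothness_const_ge1//; lra.
have nets l : exists g : K -> K,
    (#|[set g k | k : K]| <= (2 * #|I|).+1 ^ (T * 4 ^ l))%N /\
    forall k i, `|dot (y i) (t k) - dot (y i) (t (g k))| <= 2 * 2^-1 ^+ l.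
  apply: net_map p2 p'0 pp' y1 t1 _ _ _.
  - by rewrite exprn_gt0.
  - by rewrite exprn_ile1//; lra.
  - rewrite natrM natrX -mulrA -exprM mulnC exprM -exprMn.
    by rewrite (_ : 4 * 2^-1 ^+ 2 = 1) ?expr1n ?mulr1//; field.
have [g gP] := choice nets.
(* The links of the chain join the representatives of one point at consecutive scales. *)
pose A l := [set (g l.+1 k, g l k) | k : K].
pose A0 := [set g 0%N k | k : K].
pose X (e : {ffun I -> bool}) k : R := `|radsum e (f k)|.
pose Y (e : {ffun I -> bool}) l : R := \big[Num.max/0]_(j in A l)
  `|radsum e (fun i => f j.1 i - f j.2 i)|.
pose Y0 (e : {ffun I -> bool}) : R := \big[Num.max/0]_(j in A0) `|radsum e (f j)|.
have f01 k i : 0 <= f k i <= 1.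
  rewrite powR_ge0/=; have -> : 1 = (1 : R) `^ q by rewrite powR1.
  by rewrite powR_le//; lra.
have q0 : 0 <= q by lra.
have step e k : X e k <= Y0 e + \sum_(l < L) Y e l + 2 * q.
  have tele : forall l, `|radsum e (f (g l k))| <= Y0 e + \sum_(i < l) Y e i.
    elim=> [|l IH].
      rewrite big_ord0 addr0 /Y0.
      apply: (@le_bigmax_cond _ _ _ _ _ _ (fun j => `|radsum e (f j)|)).
      exact: imset_f.
    rewrite big_ord_recr/= addrA.
    have -> : radsum e (f (g l.+1 k)) = radsum e (f (g l k)) +
      radsum e (fun i => f (g l.+1 k) i - f (g l k) i).
      by rewrite radsumB addrC subrK.
    apply: (le_trans (ler_normD _ _)); apply: lerD => //.
    apply: (@le_bigmax_cond _ _ _ _ (g l.+1 k, g l k) _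
      (fun j => `|radsum e (fun i => f j.1 i - f j.2 i)|)).
    exact: imset_f.
  (* The last link needs no averaging: it has [#|I| <= 2 ^ L] terms, each at most [2 q 2^-L]. *)
  have last : `|radsum e (fun i => f k i - f (g L k) i)| <= 2 * q.
    apply: (le_trans (ler_norm_sum _ _ _)).
    apply: (@le_trans _ _ (\sum_(i : I) 2 * q * 2^-1 ^+ L)).
      apply: ler_sum => i _; rewrite normrM normr_sign mul1r.
      have h := @powR_lipschitz _ `|dot (y i) (t k)| `|dot (y i) (t (g L k))| 1 q
         (normr_ge0 _) (d1 _ _) (normr_ge0 _) (d1 _ _).
      rewrite powR1 mulr1 in h.
      apply: (le_trans (h _)); first lra.
      rewrite (mulrC 2) -mulrA ler_wpM2l//.
      exact: le_trans (ler_dist_dist _ _) ((gP L).2 k i).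
    rewrite sumr_const -[_ *+ #|_|]mulr_natr -mulrA ler_piMr//.
      by rewrite mulr_ge0.
    rewrite exprVn mulrC ler_pdivrMr ?exprn_gt0// mul1r -natrX ler_nat.
    exact: IL.
  have := tele L; rewrite radsumB in last.
  have := ler_normD (radsum e (f (g L k)))
    (radsum e (f k) - radsum e (f (g L k))).
  by rewrite addrC subrK /X; lra.
have b0 : 0 < b by lra.
have s0 : 0 < s by lra.
have avgY0 : avg Y0 <= 4 * s * b.
  apply: avg_max_radsum => // [j _|].
    apply: le_trans (tS j); rewrite /psum; apply: ler_sum => i _.
    have /andP[h0 h1] := f01 j i; rewrite -/(f j i); nra.
  apply: le_trans hb; rewrite -natrM -natrX ler_nat.
  apply: (@leq_trans ((2 * #|I|).+1 * (2 * #|I|).+1 ^ (T * 4 ^ 0))).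
    by apply: leq_mul; [case: (#|I|) I1 | exact: (gP 0%N).1].
  rewrite -expnS expn0 muln1 leq_exp2l//; last by move: I1; clear; lia.
  by move: T0; clear; lia.
(* Consecutive representatives differ by at most [3 * 2^-l], and [2 * 3^2 <= 5^2]. The two nets have
   together exponent [5 T 4^l]; raising it to [6 T 4^l] covers the factor 2 of the maximal
   inequality. *)
have avgY l : avg (Y ^~ l) <= 4 * (5 * q * s * 2^-1 ^+ l) * (b * 2 ^+ l).
  have l2 : 0 < (2^-1 : R) ^+ l by rewrite exprn_gt0.
  have l2' : 1 <= (2 : R) ^+ l by rewrite exprn_ege1//; lra.
  apply: avg_max_radsum => //.
  - by rewrite !mulr_gt0//; lra.
  - nra.
  - move=> _ /imsetP[k _ ->] /=.
    apply: (@le_trans _ _ (2 * (q * (3 * 2^-1 ^+ l)) ^+ 2 * s ^+ 2)).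
      apply: (@sum_sqr_powR_diff _ _ _ _ _ (fun i => dot (y i) (t (g l.+1 k)))
        (fun i => dot (y i) (t (g l k)))) => //.
      move=> i; have := (gP l).2 k i; have := (gP l.+1).2 k i.
      rewrite exprS; move: (dot _ _) (dot _ _) (dot _ _) => x1 x2 x3.
      rewrite !ler_norml; lra.
    rewrite -subr_ge0.
    rewrite (_ : _ - _ = 7 * (q * s * 2^-1 ^+ l) ^+ 2); last by ring.
    by rewrite mulr_ge0// sqr_ge0.
  - have AB : (#|A l| <= (2 * #|I|).+1 ^ (T * (5 * 4 ^ l)))%N.
      apply: (@leq_trans (#|[set g l.+1 k | k : K]| * #|[set g l k | k : K]|)).
        rewrite -cardsX; apply: subset_leq_card; apply/fintype.subsetP => _ /imsetP[k _ ->].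
        by rewrite finset.in_setX !imset_f.
      apply: leq_trans (leq_mul (gP l.+1).1 (gP l).1) _.
      by rewrite -expnD leq_exp2l ?expnS//; move: I1; clear; lia.
    have -> : (b * 2 ^+ l) ^+ 2 = (4 ^ l)%:R * b ^+ 2.
      by rewrite natrX exprMn mulrC -exprM mulnC exprM; congr (_ ^+ _ * _); ring.
    rewrite expRM_natl -natrM.
    apply: (@le_trans _ _ (((2 * #|I|).+1%:R ^+ (6 * T)) ^+ (4 ^ l))).
      rewrite -exprM -natrX ler_nat.
      apply: (@leq_trans ((2 * #|I|).+1 * (2 * #|I|).+1 ^ (T * (5 * 4 ^ l)))).
        by rewrite leq_mul//; move: I1; clear; lia.
      rewrite -expnS leq_exp2l; last by move: I1; clear; lia.
      have : (0 < T * 4 ^ l)%N by rewrite muln_gt0 T0 expn_gt0.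
      by clear; lia.
    by rewrite lerXn2r ?nnegrE ?expR_ge0 ?exprn_ge0.
apply: (@le_trans _ _ (avg (fun e => Y0 e + \sum_(l < L) Y e l + 2 * q))).
  apply: ler_avg => e; apply: bigmax_le => // [|k _]; last exact: step.
  rewrite !addr_ge0 ?mulr_ge0//.
    exact: bigmax_ge_id.
  by apply: sumr_ge0 => l _; exact: bigmax_ge_id.
rewrite 2!avgD avg_cst avg_sum.
have hs : \sum_(l < L) avg (Y ^~ l) <= 20 * q * s * b * L%:R.
  rewrite mulr_natr -[X in _ <= _ *+ X]card_ord -sumr_const; apply: ler_sum => l _.
  apply: (le_trans (avgY l)); rewrite le_eqVlt; apply/orP; left; apply/eqP.
  rewrite exprVn; field.
  by rewrite expf_neq0.
have bs : 1 <= b * s by nra.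
have qb : 2 * (b * s) <= q * (b * s) by rewrite ler_wpM2r//; lra.
have L0 : 0 <= L%:R * (q * (b * s)) :> R by rewrite mulr_ge0// mulr_ge0//; lra.
have : q * 1 <= q * (b * s) by rewrite ler_wpM2l.
move: avgY0 hs; nra.
Qed.

(** * Matrices with random signs *)

Definition signed (R : realType) (I J : finType) (e : I * J -> bool)
    (a : I -> J -> R) (i : I) (j : J) : R :=
  (-1) ^+ e (i, j) * a i j.

Lemma psum_signed (R : realType) (I J : finType) (e : I * J -> bool)
    (a : I -> J -> R) (p : R) (i : I) :
  psum p (signed e a i) = psum p (a i).
Proof. by apply: eq_bigr => j _; rewrite normrM normr_sign mul1r. Qed.

(** Jensen's inequality with total weight at most 1: the tangent at the weighted sum [B] is
    averaged, and the missing weight leaves a nonnegative remainder. *)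
Lemma jensen_powR (R : realType) (J : finType) (r : R) (w b : J -> R) :
  1 <= r -> (forall j, 0 <= w j) -> \sum_j w j <= 1 -> (forall j, 0 <= b j) ->
  (\sum_j w j * b j) `^ r <= \sum_j w j * b j `^ r.
Proof.
move=> r1 w0 w1 b0; set B := \sum_j w j * b j.
have B0 : 0 <= B by apply: sumr_ge0 => j _; rewrite mulr_ge0.
apply: (@le_trans _ _ (\sum_j w j * (B `^ r + r * B `^ (r - 1) * (b j - B)))).
  have -> : \sum_j w j * (B `^ r + r * B `^ (r - 1) * (b j - B)) =
      (\sum_j w j) * B `^ r + r * B `^ (r - 1) * (B - (\sum_j w j) * B).
    rewrite {4}/B !mulr_suml -sumrB mulr_sumr -big_split/=.
    by apply: eq_bigr => j _; ring.
  have -> : r * B `^ (r - 1) * (B - (\sum_j w j) * B) =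
      r * (1 - \sum_j w j) * (B * B `^ (r - 1)) by ring.
  rewrite mulr_powRB1//; last by lra.
  rewrite -subr_ge0.
  rewrite (_ : _ - _ = (r - 1) * (1 - \sum_j w j) * B `^ r); last by ring.
  by rewrite mulr_ge0 ?powR_ge0// mulr_ge0// subr_ge0.
apply: ler_sum => j _; rewrite ler_wpM2l//.
exact: powR_tangent.
Qed.

(** Khintchine's inequality for one row. Coefficients are extended by zero to all of [I * J], since
    the mean runs over the signs of the whole matrix. *)
Lemma avg_powR_row (R : realType) (I J : finType) (a : I -> J -> R) (t : J -> R)
    (q : R) (i : I) : 2 <= q ->
  avg (fun e : {ffun I * J -> bool} => `|dot (signed e a i) t| `^ q) <=
  2 * q `^ q * expR 2 * (\sum_j (a i j * t j) ^+ 2) `^ (q / 2).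
Proof.
move=> q2; pose c (x : I * J) := if x.1 == i then a i x.2 * t x.2 else 0.
have row (f : I -> J -> R) : (forall i' j, i' != i -> f i' j = 0) ->
    \sum_x f x.1 x.2 = \sum_j f i j.
  move=> f0; rewrite -(pair_bigA _ f)/= (bigD1 i)//= [X in _ + X]big1 ?addr0//.
  by move=> i' i'i; rewrite big1// => j _; rewrite f0.
have -> : \sum_j (a i j * t j) ^+ 2 = \sum_x c x ^+ 2.
  rewrite (row (fun i' j => c (i', j) ^+ 2)).
    by apply: eq_bigr => j _; rewrite /c eqxx.
  by move=> i' j /negbTE i'i; rewrite /c/= i'i expr0n.
apply: le_trans (avg_radsum_powR c q2); apply: ler_avg => e.
rewrite le_eqVlt; apply/orP; left; apply/eqP; congr (`|_| `^ _).
rewrite /radsum (eq_bigr (fun x => (-1) ^+ e (x.1, x.2) * c (x.1, x.2))).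
  rewrite (row (fun i' j => (-1) ^+ e (i', j) * c (i', j))).
    by apply: eq_bigr => j _; rewrite /c eqxx mulrA.
  by move=> i' j /negbTE i'i; rewrite /c/= i'i mulr0.
by case.
Qed.

Lemma avg_psum_fixed (R : realType) (I J : finType) (a : I -> J -> R)
    (t : J -> R) (q M : R) :
  2 <= q -> 0 <= M -> (forall j, psum q (a^~ j) <= M) -> \sum_j t j ^+ 2 <= 1 ->
  avg (fun e : {ffun I * J -> bool} => psum q (fun i => dot (signed e a i) t)) <=
  2 * q `^ q * expR 2 * M.
Proof.
move=> q2 M0 aM t1; rewrite avg_sum.
apply: (@le_trans _ _ (\sum_i 2 * q `^ q * expR 2 *
    (\sum_j t j ^+ 2 * `|a i j| `^ q))).
  apply: ler_sum => i _; apply: (le_trans (avg_powR_row _ _ _ q2)).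
  rewrite ler_wpM2l ?mulr_ge0 ?powR_ge0 ?expR_ge0//.
  have := @jensen_powR _ _ (q / 2) (fun j => t j ^+ 2) (fun j => a i j ^+ 2).
  rewrite (_ : \sum_j t j ^+ 2 * a i j ^+ 2 = \sum_j (a i j * t j) ^+ 2); last first.
    by apply: eq_bigr => j _; rewrite exprMn mulrC.
  rewrite (_ : \sum_j t j ^+ 2 * (a i j ^+ 2) `^ (q / 2) =
      \sum_j t j ^+ 2 * `|a i j| `^ q); last first.
    apply: eq_bigr => j _; rewrite -[a i j ^+ 2]real_normK ?num_real//.
    rewrite -(powR_mulrn 2 (normr_ge0 (a i j))) -powRrM.
    by congr (_ * _ `^ _); field.
  by apply => // [|j|j]; rewrite ?sqr_ge0//; lra.
rewrite -mulr_sumr ler_wpM2l ?mulr_ge0 ?powR_ge0 ?expR_ge0//.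
rewrite exchange_big/=.
apply: (@le_trans _ _ (\sum_j t j ^+ 2 * M)).
  apply: ler_sum => j _; rewrite -mulr_sumr ler_wpM2l ?sqr_ge0//; exact: aM.
by rewrite -mulr_suml; nra.
Qed.

Lemma psum_le1_norm (R : realType) (J : finType) (r : R) (t : J -> R) (j : J) :
  0 < r -> psum r t <= 1 -> `|t j| <= 1.
Proof.
move=> r0 t1; have : `|t j| `^ r <= 1.
  by apply: le_trans t1; rewrite /psum (bigD1 j)//= lerDl sumr_ge0.
apply: contraTT; rewrite -!ltNge => h.
have -> : 1 = (1 : R) `^ r by rewrite powR1.
by rewrite gt0_ltr_powR ?nnegrE.
Qed.

(** Makes the squares [t j ^ 2] admissible weights for [jensen_powR]. *)
Lemma psum_le1_sqr (R : realType) (J : finType) (p' : R) (t : J -> R) :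
  0 < p' -> p' <= 2 -> psum p' t <= 1 -> \sum_j t j ^+ 2 <= 1.
Proof.
move=> p'0 p'2 t1; apply: (le_trans _ t1); apply: ler_sum => j _.
rewrite -(real_normK (num_real (t j))) -powR_mulrn//.
have [->|tn0] := eqVneq `|t j| 0; first by rewrite !powR0//; lra.
apply: ger_powR => //; rewrite lt_neqAle eq_sym tn0 normr_ge0/=.
exact: psum_le1_norm p'0 t1.
Qed.

(* Exchanging the i-th rows of two sign matrices for all i with [d i] flips
   the signs of the corresponding summands of the symmetrised sum. *)
Definition swap_rows (I J : finType) (d : {ffun I -> bool})
    (z : {ffun I * J -> bool} * {ffun I * J -> bool}) :
    {ffun I * J -> bool} * {ffun I * J -> bool} :=
  ([ffun x => if d x.1 then z.2 x else z.1 x],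
   [ffun x => if d x.1 then z.1 x else z.2 x]).

Lemma swap_rowsK (I J : finType) (d : {ffun I -> bool}) :
  involutive (@swap_rows I J d).
Proof.
case=> e e'; rewrite /swap_rows; congr pair; apply/ffunP => x; rewrite !ffunE/=;
  by case: (d x.1).
Qed.

Lemma avg_swap_rows (R : realType) (I J : finType) (d : {ffun I -> bool})
    (H : {ffun I * J -> bool} * {ffun I * J -> bool} -> R) :
  avg (fun e => avg (fun e' => H (swap_rows d (e, e')))) =
  avg (fun e => avg (fun e' => H (e, e'))).
Proof.
rewrite /avg -[in LHS]mulr_suml -[in RHS]mulr_suml; congr (_ / _ / _).
rewrite (pair_bigA _ (fun e e' => H (swap_rows d (e, e'))))/=.
rewrite (pair_bigA _ (fun e e' => H (e, e')))/=.
rewrite [RHS](reindex_inj (inv_inj (@swap_rowsK I J d)))/=.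
by apply: eq_bigr => -[e e'] _.
Qed.

(** An independent copy [e'] stands for the mean. As [F e k i] depends only on row [i] of [e],
    swapping the rows selected by [d] preserves the joint law and puts the sign of [d i] on the
    [i]-th difference. *)
Lemma symmetrization (R : realType) (I J K : finType)
    (F : {ffun I * J -> bool} -> K -> I -> R) (G : R) :
  (forall e k i, 0 <= F e k i) ->
  (forall (e e' : {ffun I * J -> bool}) k i, (forall j, e (i, j) = e' (i, j)) ->
    F e k i = F e' k i) ->
  (forall k, avg (fun e => \sum_i F e k i) <= G) -> 0 <= G ->
  avg (fun e => \big[Num.max/0]_k \sum_i F e k i) <=
  G + 2 * avg (fun e => avg (fun d : {ffun I -> bool} =>
    \big[Num.max/0]_k `|radsum d (F e k)|)).
Proof.
move=> F0 Frow FG G0.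
pose H (z : {ffun I * J -> bool} * {ffun I * J -> bool}) : R :=
  \big[Num.max/0]_k `|\sum_i (F z.1 k i - F z.2 k i)|.
have H0 z : 0 <= H z by exact: bigmax_ge_id.
pose m (d : {ffun I -> bool}) e : R := \big[Num.max/0]_k `|radsum d (F e k)|.
apply: (@le_trans _ _ (avg (fun e => G + avg (fun e' => H (e, e'))))).
  apply: ler_avg => e; apply: bigmax_le => [|k _].
    by rewrite addr_ge0// avg_ge0.
  rewrite -[leLHS](avg_cst [the finType of (I * J)%type]).
  apply: (@le_trans _ _ (avg (fun e' => \sum_i F e' k i + H (e, e')))).
    apply: ler_avg => e'; rewrite -lerBlDl -sumrB.
    apply: (le_trans (ler_norm _)).
    exact: (@le_bigmax_cond _ _ _ _ _ _ (fun k => `|\sum_i (F e k i - F e' k i)|)).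
  by rewrite avgD lerD2r.
rewrite avgD avg_cst lerD2l.
have -> : avg (fun e => avg (fun e' => H (e, e'))) =
    avg (fun d : {ffun I -> bool} =>
      avg (fun e => avg (fun e' => H (swap_rows d (e, e'))))).
  rewrite -[LHS](avg_cst I); congr avg; apply/funext => d.
  by rewrite avg_swap_rows.
apply: (@le_trans _ _ (avg (fun d : {ffun I -> bool} =>
    avg (fun e => avg (fun e' => m d e + m d e'))))).
  apply: ler_avg => d; apply: ler_avg => e; apply: ler_avg => e'.
  have m0 e0 : 0 <= m d e0 by exact: bigmax_ge_id.
  apply: bigmax_le => [|k _]; first by rewrite addr_ge0.
  have -> : \sum_i (F (swap_rows d (e, e')).1 k i - F (swap_rows d (e, e')).2 k i) =
      radsum d (F e k) - radsum d (F e' k).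
    rewrite -radsumB; apply: eq_bigr => i _.
    have E (e1 e2 : {ffun I * J -> bool}) :
        F [ffun x => if d x.1 then e2 x else e1 x] k i =
        if d i then F e2 k i else F e1 k i.
      by case: ifP => di; apply: Frow => j; rewrite ffunE/= di.
    rewrite !E; case: (d i); last by rewrite expr0 mul1r.
    by rewrite expr1 mulN1r opprB.
  apply: (le_trans (ler_normB _ _)).
  by apply: lerD; apply: (@le_bigmax_cond _ _ _ _ _ _ (fun k => `|radsum d (F _ k)|)).
rewrite (exchange_avg (fun e (d : {ffun I -> bool}) => m d e)).
rewrite -avgZl; apply: ler_avg => d.
under [X in avg X]eq_fun do rewrite avgD avg_cst.
by rewrite avgD avg_cst mulr2n mulrDl mul1r.
Qed.

(** The chaining bound for the deviation involves the square root of the maximum [S] itself, so the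
    resulting inequality is solved for the mean of [S]. *)
Lemma signed_moment (R : realType) (I J K : finType) (p p' q b M : R)
    (a : I -> J -> R) (t : K -> J -> R) (L T : nat) :
  2 <= p -> 0 < p' -> p' <= 2 -> p^-1 + p'^-1 = 1 -> 2 <= q ->
  (forall i, psum p (a i) <= 1) -> (forall j, psum q (a^~ j) <= M) -> 0 <= M ->
  (forall k, psum p' (t k) <= 1) ->
  1 <= b -> (#|I| <= 2 ^ L)%N -> (1 < #|I|)%N -> 24 * smoothness_const p < T%:R ->
  (2 * #|I|).+1%:R ^+ (6 * T) <= expR (b ^+ 2) ->
  avg (fun e : {ffun I * J -> bool} => \big[Num.max/0]_k
        psum q (fun i => dot (signed e a i) (t k)))
    <= 4 * q `^ q * expR 2 * M + 5 * (26 * q * (L%:R + 1) * b) ^+ 2.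
Proof.
move=> p2 p'0 p'2 pp' q2 a1 aM M0 t1 b1 IL I1 hT hb.
set kap := 26 * q * (L%:R + 1) * b.
have kap1 : 1 <= kap.
  have q1 : 1 <= 26 * q by lra.
  have L1 : 1 <= L%:R + 1 :> R by rewrite lerDr.
  rewrite /kap; set X := 26 * q in q1 *; set Y := L%:R + 1 in L1 *.
  have : 1 <= X * Y by nra.
  by nra.
set G := 2 * q `^ q * expR 2 * M.
have G0 : 0 <= G by rewrite !mulr_ge0 ?powR_ge0 ?expR_ge0.
set S := fun e : {ffun I * J -> bool} => \big[Num.max/0]_k
        psum q (fun i => dot (signed e a i) (t k)).
have S0 e : 0 <= S e by exact: bigmax_ge_id.
have sym : avg S <= G + 2 * avg (fun e : {ffun I * J -> bool} =>
    avg (fun d : {ffun I -> bool} => \big[Num.max/0]_k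
      `|radsum d (fun i => `|dot (signed e a i) (t k)| `^ q)|)).
  apply: (@symmetrization _ _ _ _
    (fun e k i => `|dot (signed e a i) (t k)| `^ q)) => //.
  - move=> e e' k i ee'; congr (`|_| `^ _); apply: eq_bigr => j _.
    by rewrite /signed ee'.
  - move=> k; apply: avg_psum_fixed => //.
    exact: psum_le1_sqr p'0 p'2 (t1 k).
have chain : avg (fun e : {ffun I * J -> bool} =>
    avg (fun d : {ffun I -> bool} => \big[Num.max/0]_k
      `|radsum d (fun i => `|dot (signed e a i) (t k)| `^ q)|)) <=
    avg (fun e : {ffun I * J -> bool} => 4^-1 * S e + (4^-1 + kap ^+ 2)).
  (* The added 1 ensures [1 <= s], as chaining requires. *)
  apply: ler_avg => e; pose s := Num.sqrt (S e + 1).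
  have s2 : s ^+ 2 = S e + 1 by rewrite sqr_sqrtr// addr_ge0.
  have s1 : 1 <= s by rewrite -[leLHS]sqrtr1 ler_sqrt; have := S0 e; lra.
  apply: (@le_trans _ _ (kap * s)).
    apply: (@chaining _ _ _ _ p p' q s b (signed e a) t L T) => //.
      by move=> i; rewrite psum_signed.
    move=> k; rewrite s2; apply: (@le_trans _ _ (S e)); last by rewrite lerDl.
    exact: (@le_bigmax_cond _ _ _ _ _ _
      (fun k => psum q (fun i => dot (signed e a i) (t k)))).
  (* AM-GM: [kap s <= s^2 / 4 + kap^2], so that half of [avg S] is absorbed *)
  have := sqr_ge0 (s - 2 * kap); nra.
rewrite avgD avgZl avg_cst in chain.
have : G = 2 * q `^ q * expR 2 * M by [].
(* Solving gives [2 G + 1 + 4 kap^2]; the 1 is absorbed into a fifth [kap^2]. *)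
have : 1 <= kap ^+ 2 by rewrite exprn_ege1.
move: sym chain; clear; clearbody G kap; move: (avg _) (avg _) => x y; lra.
Qed.

(** * Logarithmic form of the bounds and passage from moments to norms *)

Lemma ln_ge_half (R : realType) (m : nat) : (2 <= m)%N -> 2^-1 <= ln (m%:R : R).
Proof.
move=> m2; have h : expR (2^-1 : R) <= 2.
  by apply: (le_trans (expR_le_quadratic _)); lra.
rewrite -ler_expR lnK ?posrE ?ltr0n; last by apply: leq_trans m2.
by apply: (le_trans h); rewrite ler_nat.
Qed.

Lemma chaining_parameters (R : realType) (p : R) (m : nat) : (2 <= m)%N ->
  let T := (Num.truncn (24 * smoothness_const p)).+1 in
  exists (L : nat) (b : R), [/\ 1 <= b, (m <= 2 ^ L)%N,
    (2 * m).+1%:R ^+ (6 * T) <= expR (b ^+ 2),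
    L%:R + 1 <= 6 * ln (m%:R : R) & b ^+ 2 = 18 * T%:R * ln (m%:R : R)].
Proof.
move=> m2 T; have lm := ln_ge_half R m2.
have m0 : 0 < m%:R :> R by rewrite ltr0n; apply: leq_trans m2.
have T1 : 1 <= T%:R :> R by rewrite ler1n.
have B1 : 1 <= 18 * T%:R * ln (m%:R : R) by nra.
(* Since [2 m + 1 <= m^3], the power [6 T] of [2 m + 1] is at most [m ^ (18 T)]. *)
exists (up_log 2 m), (Num.sqrt (18 * T%:R * ln (m%:R : R))).
have B2 : Num.sqrt (18 * T%:R * ln (m%:R : R)) ^+ 2 = 18 * T%:R * ln (m%:R : R).
  by rewrite sqr_sqrtr//; lra.
split => //.
- by rewrite -[leLHS]sqrtr1 ler_sqrt//; lra.
- exact: up_logP.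
- rewrite B2 -natrM expRM_natl lnK ?posrE// (_ : (18 * T = 3 * (6 * T))%N); last first.
    by rewrite mulnA.
  rewrite [leRHS]exprM lerXn2r ?nnegrE ?exprn_ge0// -natrX ler_nat; nia.
- have := @up_log_bounds 2 m isT m2.
  set L := up_log 2 m => /andP[hL _].
  have L0 : (0 < L)%N by rewrite up_log_gt0.
  have l2 := ln_ge_half R (leqnn 2).
  (* Minimality of [L] gives [2 ^ (L - 1) < m]; with [ln 2 >= 1/2] this yields [L - 1 <= 2 ln m],
     and the remaining 2 is at most [4 ln m]. *)
  have : L.-1%:R * ln (2 : R) <= ln m%:R.
    rewrite mulr_natl -lnXn// ler_ln ?posrE ?exprn_gt0//.
    by rewrite -natrX ler_nat ltnW.
  have -> : L%:R = L.-1%:R + 1 :> R by rewrite natr1 prednK.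
  have : 0 <= L.-1%:R :> R by [].
  nra.
Qed.

(** The cube arises as [(L + 1)^2], of order [(ln m)^2], times [b^2], of order [ln m]. *)
Lemma signed_moment_log (R : realType) (p q : R) : 2 <= p -> 2 <= q ->
  exists2 C : R, 1 <= C &
  forall (p' : R) (I J K : finType) (a : I -> J -> R) (t : K -> J -> R) (M : R),
  0 < p' -> p' <= 2 -> p^-1 + p'^-1 = 1 -> (1 < #|I|)%N ->
  (forall i, psum p (a i) <= 1) -> (forall j, psum q (a^~ j) <= M) -> 0 <= M ->
  (forall k, psum p' (t k) <= 1) ->
  avg (fun e : {ffun I * J -> bool} => \big[Num.max/0]_k
        psum q (fun i => dot (signed e a i) (t k)))
    <= C * (ln #|I|%:R ^+ 3 + M).
Proof.
move=> p2 q2; pose T := (Num.truncn (24 * smoothness_const p)).+1.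
pose c1 := 4 * q `^ q * expR 2.
pose c2 : R := 5 * (26 * q * 6) ^+ 2 * (18 * T%:R).
have c10 : 0 <= c1 by rewrite !mulr_ge0 ?powR_ge0 ?expR_ge0.
have c20 : 0 <= c2 by rewrite mulr_ge0 ?(mulr_ge0 _ (sqr_ge0 _)) ?mulr_ge0.
exists (1 + c1 + c2) => [|p' I J K a t M p'0 p'2 pp' I1 a1 aM M0 t1]; first lra.
have [L [b [b1 IL hb hL b2]]] := chaining_parameters p I1.
have lm := ln_ge_half R I1.
have hT : 24 * smoothness_const p < T%:R by rewrite truncnS_gt.
apply: (le_trans (signed_moment p2 p'0 p'2 pp' q2 a1 aM M0 t1 b1 IL I1 hT hb)).
set l := ln _ in lm hL b2 *.
have l0 : 0 <= l by apply: le_trans lm.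
have -> : (26 * q * (L%:R + 1) * b) ^+ 2 =
   (26 * q) ^+ 2 * (18 * T%:R * l) * (L%:R + 1) ^+ 2 by rewrite -b2; ring.
have hL2 : (L%:R + 1) ^+ 2 <= (6 * l) ^+ 2.
  by rewrite lerXn2r ?nnegrE ?addr_ge0 ?(mulr_ge0 _ l0).
have : (26 * q) ^+ 2 * (18 * T%:R * l) * (L%:R + 1) ^+ 2 <=
    (26 * q) ^+ 2 * (18 * T%:R * l) * (6 * l) ^+ 2.
  apply: ler_wpM2l => //; apply: mulr_ge0; first exact: sqr_ge0.
  by rewrite !mulr_ge0.
have -> : (26 * q) ^+ 2 * (18 * T%:R * l) * (6 * l) ^+ 2 = 5^-1 * c2 * l ^+ 3.
  by rewrite /c2; field.
have l3 : 0 <= l ^+ 3 by rewrite exprn_ge0//; lra.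
have := mulr_ge0 c10 l3; have := mulr_ge0 c20 M0.
rewrite -/c1; move: l3 M0; clear; clearbody c1 c2 l.
set X := (26 * q) ^+ 2 * _ * _; move: X (l ^+ 3) => X l3.
by move=> l30 M0 hM hl hX; lra.
Qed.

(** Jensen's inequality for the concave power [1 / q], through its tangent at [D]. *)
Lemma avg_powR_inv (R : realType) (I : finType) (q D : R)
    (S : {ffun I -> bool} -> R) :
  1 <= q -> 0 < D -> (forall e, 0 <= S e) -> avg S <= D ->
  avg (fun e => S e `^ q^-1) <= D `^ q^-1.
Proof.
move=> q1 D0 S0 SD; have q0 : 0 < q^-1 by rewrite invr_gt0; lra.
have q1' : q^-1 <= 1 by rewrite invf_le1//; lra.
apply: (@le_trans _ _ (avg (fun e => q^-1 * D `^ (q^-1 - 1) * S e +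
   (D `^ q^-1 - q^-1 * D `^ (q^-1 - 1) * D)))).
  apply: ler_avg => e; have := powR_concave_tangent (S0 e) D0 q0 q1'; lra.
rewrite avgD avgZl avg_cst.
have : 0 <= q^-1 * D `^ (q^-1 - 1) by rewrite mulr_ge0 ?powR_ge0// ltW.
nra.
Qed.

Lemma bigmax_lnorm_le (R : realType) (I K : finType) (q : R) (x : K -> I -> R) :
  0 < q ->
  \big[Num.max/0]_k lnorm q (x k) <= (\big[Num.max/0]_k psum q (x k)) `^ q^-1.
Proof.
move=> q0; apply: bigmax_le => [|k _]; first exact: powR_ge0.
apply: powR_le; rewrite ?invr_ge0 ?(ltW q0) ?psum_ge0//.
exact: (@le_bigmax_cond _ _ _ _ _ _ (fun k => psum q (x k))).
Qed.

Lemma psum_lnorm (R : realType) (I : finType) (q : R) (x : I -> R) :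
  0 < q -> psum q x = lnorm q x `^ q.
Proof.
by move=> q0; rewrite -powRrM mulVf ?gt_eqF// powRr1// psum_ge0.
Qed.

Lemma lnorm_ge0 (R : realType) (I : finType) (q : R) (x : I -> R) :
  0 <= lnorm q x.
Proof. exact: powR_ge0. Qed.

Lemma lnormZ (R : realType) (I : finType) (q c : R) (x : I -> R) :
  0 < q -> 0 <= c -> lnorm q (fun i => c * x i) = c * lnorm q x.
Proof.
move=> q0 c0; rewrite /lnorm -/(psum q x) -/(psum q _) psumZ powRM ?powR_ge0 ?psum_ge0//.
by rewrite -powRrM divff ?gt_eqF// powRr1// ger0_norm.
Qed.

Lemma signed_norm (R : realType) (p q : R) : 2 <= p -> 2 <= q ->
  exists2 C : R, 0 <= C &
  forall (p' : R) (I J K : finType) (a : I -> J -> R) (t : K -> J -> R) (A B : R),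
  0 < p' -> p' <= 2 -> p^-1 + p'^-1 = 1 -> (1 < #|I|)%N ->
  (forall i, lnorm p (a i) <= A) -> (forall j, lnorm q (a^~ j) <= B) ->
  0 <= A -> 0 <= B -> (forall k, psum p' (t k) <= 1) ->
  avg (fun e : {ffun I * J -> bool} => \big[Num.max/0]_k
        lnorm q (fun i => dot (signed e a i) (t k)))
    <= C * (ln #|I|%:R `^ (3 / q) * A + B).
Proof.
move=> p2 q2; have [C C1 hC] := signed_moment_log p2 q2.
have q0 : 0 < q by lra.
exists ((2 * C) `^ q^-1); first exact: powR_ge0.
move=> p' I J K a t A B p'0 p'2 pp' I1 aA aB + B0 t1.
have lm := ln_ge_half R I1; set l := ln _ in lm *.
have l0 : 0 <= l by lra.
set l3 := l `^ (3 / q).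
have l30 : 0 < l3 by rewrite powR_gt0//; lra.
(* The rows are to be divided by [A]; the case [A = 0] follows by letting [z] tend to 0 in the bound
   for [A + z]. *)
wlog A0 : A aA / 0 < A.
  move=> wl A0; apply/ler_addgt0Pr => eps eps0.
  pose D := (2 * C) `^ q^-1 * l3.
  have D0 : 0 < D by rewrite mulr_gt0 ?powR_gt0//; lra.
  have [z z0 zE] : exists2 z, 0 < z & eps = D * z.
    by exists (eps / D); rewrite ?divr_gt0// mulrC divfK// gt_eqF.
  have := wl (A + z); move=> /(_ _ _ _)/le_trans; apply.
  - by move=> i; apply: (le_trans (aA i)); rewrite lerDl ltW.
  - by rewrite ltr_wpDl.
  - by rewrite addr_ge0// ltW.
  - by rewrite zE /D le_eqVlt; apply/orP; left; apply/eqP; ring.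
move=> _.
pose a' i j := A^-1 * a i j.
have iA0 : 0 <= A^-1 by rewrite invr_ge0 ltW.
pose M := (B / A) `^ q.
have M0 : 0 <= M by exact: powR_ge0.
have a'1 i : psum p (a' i) <= 1.
  rewrite psum_lnorm ?lnormZ//; try lra.
  have -> : 1 = (1 : R) `^ p by rewrite powR1.
  by apply: powR_le; rewrite ?mulr_ge0 ?lnorm_ge0 ?ler_pdivrMl ?mulr1//; lra.
have a'M j : psum q (a'^~ j) <= M.
  rewrite psum_lnorm ?(@lnormZ _ _ q A^-1 (a^~ j))//.
  apply: powR_le; rewrite ?mulr_ge0 ?lnorm_ge0//; first lra.
  by rewrite mulrC ler_wpM2r.
have h := hC p' I J K a' t M p'0 p'2 pp' I1 a'1 a'M M0 t1.
(* Since [l3 ^ q = l ^ 3] and [M = (B / A) ^ q], this dominates the moment bound and has an explicit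
   [q]-th root. *)
pose D := 2 * C * (l3 + B / A) `^ q.
have BA0 : 0 <= B / A by rewrite divr_ge0// ltW.
have D0 : 0 < D.
  by rewrite mulr_gt0 ?powR_gt0//; lra.
have hD : avg (fun e : {ffun I * J -> bool} => \big[Num.max/0]_k
        psum q (fun i => dot (signed e a' i) (t k))) <= D.
  apply: (le_trans h); rewrite /D (mulrC 2) -mulrA ler_wpM2l//; first lra.
  have h1 : l ^+ 3 <= (l3 + B / A) `^ q.
    have -> : l ^+ 3 = l3 `^ q.
      by rewrite -powRrM divfK ?gt_eqF// powR_mulrn.
    by apply: powR_le; rewrite ?(ltW l30) ?lerDl//; lra.
  have h2 : M <= (l3 + B / A) `^ q.
    by apply: powR_le; rewrite ?lerDr ?(ltW l30)//; lra.
  by rewrite -/l; lra.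
have S0 (e : {ffun I * J -> bool}) : 0 <= \big[Num.max/0]_k
        psum q (fun i => dot (signed e a' i) (t k)).
  by exact: bigmax_ge_id.
have h2 := avg_powR_inv (le_trans (@ler1n _ 2) q2) D0 S0 hD.
have h3 : avg (fun e : {ffun I * J -> bool} => \big[Num.max/0]_k
        lnorm q (fun i => dot (signed e a i) (t k))) <=
    A * D `^ q^-1.
  rewrite -ler_pdivrMl//; apply: le_trans h2.
  rewrite -avgZl; apply: ler_avg => e.
  apply: le_trans (bigmax_lnorm_le _ q0).
  rewrite ler_pdivrMl//; apply: bigmax_le => [|k _].
    rewrite mulr_ge0 ?(ltW A0)//.
    exact: bigmax_ge_id.
  have -> : (fun i => dot (signed e a i) (t k)) =
      (fun i => A * dot (signed e a' i) (t k)).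
    apply/funext => i; rewrite /dot mulr_sumr; apply: eq_bigr => j _.
    by rewrite /signed /a' -!mulrA [RHS]mulrCA mulVKf// gt_eqF.
  rewrite (lnormZ _ q0 (ltW A0)) ler_pM2l//.
  exact: (@le_bigmax_cond _ _ _ _ _ _
    (fun k => lnorm q (fun i => dot (signed e a' i) (t k)))).
apply: (le_trans h3); rewrite le_eqVlt; apply/orP; left; apply/eqP.
rewrite /D powRM ?powR_ge0//; last by lra.
rewrite -powRrM divff ?gt_eqF// powRr1; last by lra.
by field; rewrite gt_eqF.
Qed.

(** * Operator norm and expectation *)

(** Rounding each coordinate towards zero on a grid of mesh [1 / N] stays in the ball. Four times
    the error is at most [4 / N <= 1] per coordinate, so its [r]-th powers sum to at most
    [4 #|J| / N <= 1]. *)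
Lemma ball_net (R : realType) (J : finType) (r : R) : 1 <= r ->
  exists (K : finType) (t : K -> J -> R), (forall k, psum r (t k) <= 1) /\
    forall x, psum r x <= 1 -> exists k, psum r (fun j => 4 * (x j - t k j)) <= 1.
Proof.
move=> r1; have r0 : 0 < r by lra.
pose N := (4 * #|J|).+1.
have N0 : 0 < N%:R :> R by [].
pose v (k : {ffun J -> bool * 'I_N.+1}) j : R := (-1) ^+ (k j).1 * ((k j).2%:R / N%:R).
(* Grid points outside the ball are replaced by 0. *)
pose t k := if psum r (v k) <= 1 then v k else fun _ => 0.
exists {ffun J -> bool * 'I_N.+1}, t; split=> [k|x x1].
  rewrite /t; case: ifP => // _; rewrite /psum big1// => j _.
  by rewrite normr0 powR0// gt_eqF.
have x1j j : `|x j| <= 1 by exact: psum_le1_norm r0 x1.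
pose f j := Num.truncn (N%:R * `|x j|).
have fle j : (f j)%:R <= N%:R * `|x j| by rewrite truncn_le ?mulr_ge0.
have flt j : N%:R * `|x j| < (f j)%:R + 1 by rewrite natr1 truncnS_gt.
have fN j : (f j < N.+1)%N.
  rewrite ltnS -(ler_nat R); apply: le_trans (fle j) _.
  by rewrite ler_piMr.
pose k := [ffun j => (x j < 0, Ordinal (fN j))].
have vE j : v k j = (-1) ^+ (x j < 0)%R * ((f j)%:R / N%:R) by rewrite /v ffunE.
have vx j : `|v k j| <= `|x j|.
  rewrite vE normrM normr_sign mul1r ger0_norm; last by rewrite divr_ge0.
  by rewrite ler_pdivrMr// mulrC.
have tE : t k = v k.
  rewrite /t ifT//; apply: le_trans x1; apply: ler_sum => j _.
  by apply: powR_le; rewrite ?normr_ge0// ltW.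
have dist j : `|x j - v k j| <= N%:R^-1.
  have -> : x j - v k j = (-1) ^+ (x j < 0)%R * (`|x j| - (f j)%:R / N%:R).
    by rewrite vE mulrBr -numEsign.
  rewrite normrM normr_sign mul1r ger0_norm ?subr_ge0; last first.
    by rewrite ler_pdivrMr// mulrC.
  rewrite -[leRHS]mul1r -(ler_pM2r N0) divfK ?gt_eqF//.
  by rewrite mulrBl divfK ?gt_eqF// mulrC; have := flt j; lra.
exists k; rewrite tE.
apply: (@le_trans _ _ (\sum_(j : J) 4 / N%:R)).
  apply: ler_sum => j _; have N4 : 4 / N%:R <= 1 :> R.
    rewrite ler_pdivrMr// mul1r ler_nat /N.
    have : (0 < #|J|)%N by apply/card_gt0P; exists j.
    by case: #|J| => // c _; rewrite mulnS ltnS leq_addr.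
  apply: (@le_trans _ _ ((4 / N%:R) `^ r)).
    by apply: powR_le; rewrite ?(ltW r0)// normrM ger0_norm// ler_pM2l// dist.
  by rewrite ge1r_powR// divr_gt0.
rewrite sumr_const -[_ *+ #|_|]mulr_natl mulrA ler_pdivrMr// mul1r.
by rewrite -natrM ler_nat /N mulnC.
Qed.

Lemma lnorm_le (R : realType) (I : finType) (q : R) (x y : I -> R) :
  0 < q -> (forall i, `|x i| <= `|y i|) -> lnorm q x <= lnorm q y.
Proof.
move=> q0 xy; apply: powR_le; first by rewrite invr_ge0 ltW.
  exact: psum_ge0.
by apply: ler_sum => i _; rewrite powR_le ?normr_ge0 ?(ltW q0).
Qed.

Lemma lnorm_le1 (R : realType) (I : finType) (q : R) (x : I -> R) :
  0 < q -> (lnorm q x <= 1) = (psum q x <= 1).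
Proof.
move=> q0; apply/idP/idP => h.
  rewrite psum_lnorm//; have -> : 1 = (1 : R) `^ q by rewrite powR1.
  by apply: powR_le; rewrite ?lnorm_ge0 ?(ltW q0).
have -> : 1 = (1 : R) `^ q^-1 by rewrite powR1.
by apply: powR_le => //; [rewrite invr_ge0 ltW | exact: psum_ge0].
Qed.

Lemma opnorm_ub (R : realType) (r q : R) (m n : nat) (A : 'M[R]_(m, n)) :
  0 < r -> 0 < q ->
  has_ubound [set lnorm q (fun i => (A *m t) i 0) |
       t in [set t : 'cV[R]_n | lnorm r (fun j => t j 0) <= 1]].
Proof.
move=> r0 q0.
exists (lnorm q (fun i => \sum_j `|A i j|)) => _ [t /= t1 <-].
rewrite lnorm_le1// in t1.
apply: lnorm_le => // i; rewrite mxE [leRHS]ger0_norm ?sumr_ge0//.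
apply: (le_trans (ler_norm_sum _ _ _)); apply: ler_sum => j _.
by rewrite normrM ler_piMr//; exact: psum_le1_norm r0 t1.
Qed.

Lemma powR_normD_le (R : realType) (q u w : R) : 0 <= q ->
  `|u + w| `^ q <= 2 `^ q * (`|u| `^ q + `|w| `^ q).
Proof.
move=> q0; have [uw|/ltW wu] := leP `|u| `|w|.
  apply: (@le_trans _ _ ((2 * `|w|) `^ q)).
    by apply: powR_le => //; apply: (le_trans (ler_normD _ _)); lra.
  by rewrite powRM// ler_wpM2l ?powR_ge0// lerDr powR_ge0.
apply: (@le_trans _ _ ((2 * `|u|) `^ q)).
  by apply: powR_le => //; apply: (le_trans (ler_normD _ _)); lra.
by rewrite powRM// ler_wpM2l ?powR_ge0// lerDl powR_ge0.
Qed.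

(** Every [x] in the ball is [t k + y / 4] with [y] in the ball. The crude bound [powR_normD_le]
    yields [O^q <= (2 g)^q + (O / 2)^q], and [(O / 2)^q <= O^q / 4] is absorbed. *)
Lemma opnorm_le_net (R : realType) (r q : R) (m n : nat) (A : 'M[R]_(m, n))
    (K : finType) (t : K -> 'I_n -> R) :
  0 < r -> 2 <= q ->
  (forall x, psum r x <= 1 -> exists k, psum r (fun j => 4 * (x j - t k j)) <= 1) ->
  opnorm r q A <= 4 * \big[Num.max/0]_k lnorm q (fun i => dot (A i) (t k)).
Proof.
move=> r0 q2 net; have q0 : 0 < q by lra.
set g := \big[Num.max/0]_k _; set O := opnorm r q A.
have g0 : 0 <= g by exact: bigmax_ge_id.
have sup_ge x : psum r x <= 1 -> lnorm q (fun i => dot (A i) x) <= O.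
  move=> x1; apply: ub_le_sup; first exact: opnorm_ub.
  exists (\col_j x j) => /=.
    by rewrite lnorm_le1//; under eq_fun do rewrite mxE.
  by congr lnorm; apply/funext => i; rewrite mxE; apply: eq_bigr => j _; rewrite mxE.
have O0 : 0 <= O.
  apply: (le_trans _ (sup_ge (fun _ => 0) _)); first exact: lnorm_ge0.
  by rewrite /psum big1// => j _; rewrite normr0 powR0// gt_eqF.
pose D := 2 `^ q * (g `^ q + (O / 4) `^ q).
have D0 : 0 <= D by rewrite mulr_ge0 ?addr_ge0 ?powR_ge0.
have OD : O <= D `^ q^-1.
  apply: ge_sup.
    exists (lnorm q (fun i => (A *m (0 : 'cV_n)) i 0)), 0 => //=.
    rewrite lnorm_le1// /psum big1// => j _.
    by rewrite mxE normr0 powR0// gt_eqF.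
  move=> _ [x /= x1 <-]; rewrite lnorm_le1// in x1.
  have [k hk] := net _ x1.
  set y := fun j => 4 * _ in hk.
  have gk : lnorm q (fun i => dot (A i) (t k)) <= g.
    exact: (@le_bigmax_cond _ _ _ _ _ _ (fun k => lnorm q (fun i => dot (A i) (t k)))).
  have yO := sup_ge _ hk.
  apply: powR_le; rewrite ?invr_ge0 ?(ltW q0)//; first exact: psum_ge0.
  apply: (@le_trans _ _ (\sum_i 2 `^ q * (`|dot (A i) (t k)| `^ q +
      4^-1 `^ q * `|dot (A i) y| `^ q))).
    apply: ler_sum => i _.
    have -> : (A *m x) i 0 = dot (A i) (t k) + 4^-1 * dot (A i) y.
      rewrite mxE -dotZr -dotDr; apply: eq_bigr => j _.
      by rewrite /y; congr (_ * _); field.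
    rewrite -powRM ?normr_ge0 ?invr_ge0//.
    rewrite -[4^-1 in leRHS]ger0_norm ?invr_ge0// -normrM.
    by apply: powR_normD_le; exact: ltW.
  rewrite -mulr_sumr ler_wpM2l ?powR_ge0// big_split/= -mulr_sumr.
  rewrite -/(psum q (fun i => dot (A i) (t k))) -/(psum q (fun i => dot (A i) y)).
  rewrite !psum_lnorm// lerD//.
    by apply: powR_le; rewrite ?lnorm_ge0 ?(ltW q0).
  rewrite -powRM ?lnorm_ge0 ?invr_ge0//.
  apply: powR_le; rewrite ?(ltW q0)//; first by rewrite mulr_ge0 ?invr_ge0 ?lnorm_ge0.
  by rewrite mulrC ler_wpM2r ?invr_ge0.
have OqD : O `^ q <= D.
  have qn0 : q != 0 by rewrite gt_eqF.
  rewrite -[leRHS](powRr1 D0) -(mulVf qn0) powRrM.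
  by apply: powR_le; rewrite ?(ltW q0).
have h2 : 2 `^ q * (O / 4) `^ q <= 4^-1 * O `^ q.
  rewrite -powRM ?divr_ge0// (_ : 2 * (O / 4) = 2^-1 * O); last by field.
  rewrite powRM ?invr_ge0// ler_wpM2r ?powR_ge0//.
  rewrite (_ : 4^-1 = 2^-1 `^ 2); last by rewrite powR_mulrn ?invr_ge0//; field.
  by apply: ger_powR => //; move: q2; clear; lra.
have h3 : O `^ q <= (4 * g) `^ q.
  have -> : (4 * g) `^ q = 2 `^ q * (2 `^ q * g `^ q).
    by rewrite -!powRM// ?mulr_ge0// mulrA -natrM.
  have h4 : 4 <= 2 `^ q :> R.
    rewrite (_ : 4 = 2 `^ 2); last by rewrite powR_mulrn//; ring.
    by apply: ler_powR => //; move: q2; clear; lra.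
  have G0 : 0 <= 2 `^ q * g `^ q by rewrite mulr_ge0 ?powR_ge0.
  have := ler_wpM2r G0 h4.
  rewrite /D mulrDr in OqD; move: G0 OqD h2.
  move: (2 `^ q * (O / 4) `^ q) (2 `^ q * g `^ q) (O `^ q) (2 `^ q) => x y z u.
  by clear; lra.
rewrite leNgt; apply/negP => h.
have : (4 * g) `^ q < O `^ q by rewrite gt0_ltr_powR ?nnegrE ?mulr_ge0.
by rewrite ltNge h3.
Qed.

(* The library's [ge0_le_integral] asks that both functions be measurable,
   which would have to be proved for the operator norm. *)
Lemma ge0_le_integral_nonmeasurable (R : realType) d (T : measurableType d)
    (mu : {measure set T -> \bar R}) (f1 f2 : T -> \bar R) :
  (forall x, 0 <= f1 x)%E -> (forall x, f1 x <= f2 x)%E ->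
  (\int[mu]_x f1 x <= \int[mu]_x f2 x)%E.
Proof.
move=> f10 f12.
have f20 x : (0 <= f2 x)%E by exact: le_trans (f12 x).
rewrite !ge0_integralTE//; apply: ereal_sup_le => _ [h hf <-].
by exists h => // x; exact: le_trans (f12 x).
Qed.

(** Change of variables to the common image measure; this turns unconditionality into equality of
    means. *)
Lemma eq_pushforward_integral (R : realType) d d' (X : measurableType d)
    (Y : measurableType d') (mu : {measure set X -> \bar R}) (phi psi : X -> Y)
    (f : Y -> \bar R) :
  measurable_fun setT phi -> measurable_fun setT psi -> measurable_fun setT f ->
  (forall y, 0 <= f y)%E ->
  (forall A, measurable A -> pushforward mu phi A = pushforward mu psi A) ->
  (\int[mu]_x f (phi x) = \int[mu]_x f (psi x))%E.
Proof.
move=> mphi mpsi mf f0 eqA.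
pose phi' : {mfun X >-> Y} := HB.pack phi (isMeasurableFun.Build _ _ _ _ _ mphi).
pose psi' : {mfun X >-> Y} := HB.pack psi (isMeasurableFun.Build _ _ _ _ _ mpsi).
have h1 := ge0_integral_pushforward mphi mu measurableT mf (fun y _ => f0 y).
have h2 := ge0_integral_pushforward mpsi mu measurableT mf (fun y _ => f0 y).
rewrite !preimage_setT in h1 h2.
transitivity (\int[pushforward mu phi]_y f y)%E; first by rewrite h1.
transitivity (\int[pushforward mu psi]_y f y)%E; last by rewrite h2.
by apply: (@eq_measure_integral _ _ _ _ (pushforward mu psi') (pushforward mu phi')) => A mA _;
  exact: eqA.
Qed.

Lemma measurable_bigmaxr (R : realType) d (T : measurableType d) (I : Type)
    (s : seq I) (f : I -> T -> R) :
  (forall i, measurable_fun setT (f i)) ->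
  measurable_fun setT (fun w => \big[Num.max/0]_(i <- s) f i w).
Proof.
move=> mf; elim: s => [|i s ih].
  by under eq_fun do rewrite big_nil; exact: measurable_cst.
by under eq_fun do rewrite big_cons; exact: measurable_maxr.
Qed.

Lemma measurable_lnorm (R : realType) d (T : measurableType d) (I : finType)
    (q : R) (f : I -> T -> R) :
  (forall i, measurable_fun setT (f i)) ->
  measurable_fun setT (fun w => lnorm q (fun i => f i w)).
Proof.
move=> mf; apply: (@measurableT_comp _ _ _ _ _ _ (@powR R ^~ q^-1)).
  exact: measurable_powR.
apply: measurable_sum => i.
apply: (@measurableT_comp _ _ _ _ _ _ (@powR R ^~ q)); first exact: measurable_powR.
exact: measurableT_comp.
Qed.

(** * Absorption of logarithms and proof of the theorem *)

(** As [l] may be below 1, exponents are compared for [2 l >= 1], at the price of [2 ^ b <= 4]. *)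
Lemma powR_exponent_le (R : realType) (l a b : R) :
  2^-1 <= l -> 0 <= a -> a <= b -> b <= 2 -> l `^ a <= 4 * l `^ b.
Proof.
move=> l2 a0 ab b2; have l0 : 0 <= l by lra.
apply: (@le_trans _ _ ((2 * l) `^ a)); first by apply: powR_le; lra.
apply: (@le_trans _ _ ((2 * l) `^ b)); first by apply: ler_powR; lra.
rewrite powRM// ler_wpM2r ?powR_ge0//.
rewrite (_ : 4 = 2 `^ 2); last by rewrite powR_mulrn//; ring.
by apply: ler_powR; lra.
Qed.

Lemma sqrt_ln_ge (R : realType) (n : nat) : (2 <= n)%N ->
  1 <= 4 * Num.sqrt (ln n%:R : R).
Proof.
move=> n2; have ln2 := ln_ge_half R n2.
have s0 := sqrtr_ge0 (ln n%:R : R).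
have := @sqr_sqrtr R (ln n%:R); set s := Num.sqrt _ in s0 *; nra.
Qed.

Lemma conjugate_le2 (R : realType) (p p' : R) :
  2 <= p -> p^-1 + p'^-1 = 1 -> [/\ 1 <= p', 0 < p' & p' <= 2].
Proof.
move=> p2 pp'; have p0 : 0 < p by lra.
have ip0 : 0 < p^-1 by rewrite invr_gt0.
have ip2 : p^-1 <= 2^-1 by rewrite lef_pV2// posrE.
have p'0 : 0 < p' by rewrite -invr_gt0; lra.
split => //.
  by rewrite -(invrK p') invf_ge1 ?invr_gt0//; lra.
by rewrite -lef_pV2 ?posrE//; lra.
Qed.

Theorem corollary1p6 (R : realType) (p q : R) (hp : 2 <= p) (hq : 2 <= q) :
  exists C : R,
    forall (p' : R), p^-1 + p'^-1 = 1 ->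
    forall (m n : nat), (2 <= m)%N -> (2 <= n)%N ->
    forall (d : measure_display) (T : measurableType d) (P : probability T R)
      (X : 'I_m -> 'I_n -> {RV P >-> R}),
    unconditional (fun ij : 'I_m * 'I_n => X ij.1 ij.2) ->
    ('E_P[fun w => opnorm p' q (\matrix_(i < m, j < n) X i j w)]
     <= C%:E *
        ((ln m%:R `^ (3 / 2 + 1 / q))%:E *
           'E_P[fun w => \big[Num.max/0%R]_(i < m) lnorm p (fun j => X i j w)]
         + (Num.sqrt (ln n%:R))%:E *
           'E_P[fun w => \big[Num.max/0%R]_(j < n) lnorm q (fun i => X i j w)]))%E.
Proof.
have [C C0 hC] := signed_norm hp hq.
(* One factor 4 comes from the net, the other from adjusting the logarithms. *)
exists (16 * C) => p' pp' m n m2 n2 d T P X unc.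
have [p'1 p'0 p'2] := conjugate_le2 hp pp'.
have q0 : 0 < q by lra.
have [K [t [t1 net]]] := ball_net 'I_n p'1.
pose I : finType := ('I_m * 'I_n)%type.
(* The maximum over the net as a measurable function of the tuple of entries, so that the law of the
   matrix determines its mean. *)
pose G (x : #|I|.-tuple R) : R := \big[Num.max/0]_k
  lnorm q (fun i => dot (fun j => tnth x (enum_rank ((i, j) : I))) (t k)).
have G0 x : 0 <= G x by exact: bigmax_ge_id.
have mG : measurable_fun setT G.
  apply: measurable_bigmaxr => k; apply: measurable_lnorm => i.
  apply: measurable_sum => j; apply: measurable_funM => //.
  exact: measurable_tnth.
pose Z (e : {ffun I -> bool}) := joint (fun ij w => (-1) ^+ e ij * X ij.1 ij.2 w).
have mZ e : measurable_fun setT (Z e).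
  apply/measurable_fun_tnthP => i.
  rewrite (_ : _ \o _ = fun w => (-1) ^+ e (enum_val i) *
      X (enum_val i).1 (enum_val i).2 w); first exact: measurable_funM.
  by apply/funext => w /=; rewrite tnth_mktuple.
have mX : measurable_fun setT (joint (fun ij : I => X ij.1 ij.2 : T -> R)).
  apply/measurable_fun_tnthP => i.
  rewrite (_ : _ \o _ = X (enum_val i).1 (enum_val i).2)//.
  by apply/funext => w /=; rewrite tnth_mktuple.
have GZ e w : G (Z e w) = \big[Num.max/0]_k
    lnorm q (fun i => dot (signed e (fun i j => X i j w) i) (t k)).
  apply: eq_bigr => k _; congr lnorm; apply/funext => i; apply: eq_bigr => j _.
  by rewrite tnth_mktuple enum_rankK.
have GX w : G (joint (fun ij : I => X ij.1 ij.2 : T -> R) w) = \big[Num.max/0]_k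
    lnorm q (fun i => dot ((\matrix_(i < m, j < n) X i j w) i) (t k)).
  apply: eq_bigr => k _; congr lnorm; apply/funext => i; apply: eq_bigr => j _.
  by rewrite tnth_mktuple enum_rankK mxE.
pose c := (\int[P]_w (G (joint (fun ij : I => X ij.1 ij.2 : T -> R) w))%:E)%E.
(* By unconditionality no fixed sign pattern changes the mean. *)
have cZ e : (\int[P]_w (G (Z e w))%:E)%E = c.
  apply: (@eq_pushforward_integral _ _ _ _ _ P (Z e) _ (fun x => (G x)%:E)) => //.
  - exact/measurable_EFinP.
  - by move=> A mA; apply/esym; exact: unc.
pose F1 w := \big[Num.max/0]_(i < m) lnorm p (fun j => X i j w).
pose F2 w := \big[Num.max/0]_(j < n) lnorm q (fun i => X i j w).
have F10 w : 0 <= F1 w by exact: bigmax_ge_id.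
have F20 w : 0 <= F2 w by exact: bigmax_ge_id.
have mF1 : measurable_fun setT F1.
  by apply: measurable_bigmaxr => i; exact: measurable_lnorm.
have mF2 : measurable_fun setT F2.
  by apply: measurable_bigmaxr => i; exact: measurable_lnorm.
set lm := ln m%:R `^ (3 / 2 + 1 / q); set sn := Num.sqrt (ln n%:R).
have lm0 : 0 <= lm by exact: powR_ge0.
have sn0 : 0 <= sn by exact: sqrtr_ge0.
have havg w : avg (fun e => G (Z e w)) <= 4 * C * (lm * F1 w + sn * F2 w).
  have -> : (fun e => G (Z e w)) = (fun e => \big[Num.max/0]_k
    lnorm q (fun i => dot (signed e (fun i j => X i j w) i) (t k))).
    by apply/funext => e; rewrite GZ.
  apply: le_trans (hC p' _ _ _ (fun i j => X i j w) t (F1 w) (F2 w)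
    p'0 p'2 pp' _ _ _ _ _ t1) _ => //.
  - by rewrite card_ord.
  - by move=> i; apply: (@le_bigmax_cond _ _ _ _ _ _ (fun i => lnorm p (fun j => X i j w))).
  - by move=> j; apply: (@le_bigmax_cond _ _ _ _ _ _ (fun j => lnorm q (fun i => X i j w))).
  rewrite (mulrC 4) -mulrA ler_wpM2l// mulrDr !mulrA lerD//.
    (* From [1 / q <= 1 / 2] follow [3 / q <= 3 / 2 + 1 / q] and [3 / 2 + 1 / q <= 2]. *)
    rewrite ler_wpM2r// card_ord; apply: powR_exponent_le.
    - exact: ln_ge_half.
    - by rewrite divr_ge0// ltW.
    - have : q^-1 <= 2^-1 by rewrite lef_pV2 ?posrE.
      by lra.
    - have : q^-1 <= 2^-1 by rewrite lef_pV2 ?posrE.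
      by lra.
  by rewrite ler_peMl// sqrt_ln_ge.
pose N := #|{ffun I -> bool}|.
have N0 : N%:R != 0 :> R.
  by rewrite pnatr_eq0 /N card_ffun card_bool expn_eq0.
have mGZ e : measurable_fun setT (fun w => (G (Z e w))%:E).
  by apply/measurable_EFinP; exact: measurableT_comp.
(* The average over signs moves inside the integral, where [havg] bounds it for each outcome [w]. *)
have cavg : (\int[P]_w (avg (fun e => G (Z e w)))%:E)%E = c.
  have -> : (fun w => (avg (fun e => G (Z e w)))%:E) =
      (fun w => (N%:R^-1)%:E * \sum_(e : {ffun I -> bool}) (G (Z e w))%:E)%E.
    by apply/funext => w; rewrite sumEFin -EFinM mulrC.
  rewrite ge0_integralZl_EFin//; last first.
  - by apply: emeasurable_sum => e; exact: mGZ.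
  - by move=> w _; rewrite sume_ge0// => e _; rewrite lee_fin.
  rewrite ge0_integral_sum//; last by move=> e w _; rewrite lee_fin.
  rewrite (eq_bigr (fun=> c)) => [|e _]; last exact: cZ.
  (* The mean [c] may be infinite, so the computation stays in the extended reals. *)
  have natmulE k : (c *+ k)%R = (k%:R%:E * c)%E.
    elim: k => [|k ih]; first by rewrite mulr0n mul0e.
    by rewrite mulrS ih -nat1r EFinD ge0_muleDl ?lee_fin// mul1e.
  by rewrite sumr_const natmulE muleA -EFinM mulVf ?mul1e.
rewrite unlock; apply: (@le_trans _ _ (4%:E * c)%E).
  rewrite /c -ge0_integralZl_EFin//; last first.
  - by apply/measurable_EFinP; exact: measurableT_comp.
  - by move=> w _; rewrite lee_fin.
  apply: ge0_le_integral_nonmeasurable => w.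
    rewrite lee_fin; apply: (@le_trans _ _ (lnorm q (fun i =>
      ((\matrix_(i < m, j < n) X i j w) *m (0 : 'cV_n)) i 0))).
      exact: lnorm_ge0.
    apply: ub_le_sup; first exact: opnorm_ub.
    exists 0 => //=; rewrite lnorm_le1// /psum big1// => j _.
    by rewrite mxE normr0 powR0// gt_eqF.
  by rewrite -EFinM lee_fin GX; exact: opnorm_le_net net.
have -> : (16 * C)%:E = (4%:E * (4 * C)%:E)%E by rewrite -EFinM; congr EFin; ring.
rewrite -muleA lee_pmul2l// -cavg.
have C40 : 0 <= 4 * C by rewrite mulr_ge0.
have mfin (a : R) (f : T -> R) : measurable_fun setT f ->
    measurable_fun setT (fun w => a%:E * (f w)%:E)%E.
  move=> mf; under eq_fun do rewrite -EFinM; apply/measurable_EFinP.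
  exact: measurable_funM.
apply: (@le_trans _ _ (\int[P]_w ((4 * C)%:E *
    (lm%:E * (F1 w)%:E + sn%:E * (F2 w)%:E)))%E).
  apply: ge0_le_integral_nonmeasurable => w; last by rewrite -!EFinM lee_fin.
  by rewrite lee_fin avg_ge0.
rewrite ge0_integralZl_EFin//; last first.
- by apply: emeasurable_funD; exact: mfin.
- by move=> w _; rewrite -!EFinM -EFinD lee_fin addr_ge0 ?mulr_ge0.
rewrite ge0_integralD//; last 4 first.
- by move=> w _; rewrite -EFinM lee_fin mulr_ge0.
- exact: mfin.
- by move=> w _; rewrite -EFinM lee_fin mulr_ge0.
- exact: mfin.
rewrite !ge0_integralZl_EFin//.
- by move=> w _; rewrite lee_fin.
- exact/measurable_EFinP.
- by move=> w _; rewrite lee_fin.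
- exact/measurable_EFinP.
Qed.
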